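(* Let $K$ be a field, let $G$ be a simple graph on the vertex set $V(G)=[n]=\{1,\dots,n\}$ with edge set $E(G)$, and let $R_G=S/P_G$, where $S=K[x_{ij}: 1\le i,j\le n]$ and $P_G$ is the ideal of $S$ generated by the binomials $x_{ii}x_{jj}-x_{ij}x_{ji}$ with $\{i,j\}\in E(G)$, $i<j$. Then the divisor class group $\operatorname{Cl}(R_G)$ is a free abelian group of rank $$\sum_{i\in V(G)}2^{\deg i}-n-|E(G)|.$$
   Context: $S$ is the polynomial ring over $K$ in the $n^2$ variables $x_{ij}$, $1\le i,j\le n$. Here $\deg i$ is the degree of the vertex $i$ in $G$ (the number of edges containing $i$). The ring $R_G$ is a normal Noetherian domain, so its divisor class group (divisorial divisors modulo principal divisors) is defined. *)

(* Defs.v *)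
From HB Require Import structures.
From mathcomp Require Import all_boot all_order all_algebra.
From mathcomp Require Import boolp classical_sets.
From mathcomp Require Import mpoly zify.

Set Implicit Arguments.
Unset Strict Implicit.
Unset Printing Implicit Defensive.

Import GRing.Theory.
Local Open Scope ring_scope.
Local Open Scope quotient_scope.

Section Divisors.
Variable R : idomainType.
Local Notation F := {fraction R}.
Local Open Scope classical_set_scope.

Definition in_base : set F := [set x | exists r : R, x = FracField.tofrac r].

Definition submodule (I : set F) : Prop :=
  [/\ I 0, forall x y, I x -> I y -> I (x + y)
    & forall (r : R) x, I x -> I (FracField.tofrac r * x)].

Definition fractional_ideal (I : set F) : Prop :=
  [/\ submodule I, exists2 x, I x & x != 0
    & exists2 d : R, d != 0 & forall x, I x -> in_base (FracField.tofrac d * x)].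

(* (R :_F I), the fractional ideal usually written I^-1. *)
Definition dual (I : set F) : set F :=
  [set x | forall y, I y -> in_base (x * y)].

Definition divisorial (I : set F) : Prop :=
  fractional_ideal I /\ dual (dual I) = I.

Definition ideal_mul (I J : set F) : set F :=
  [set x | exists s : seq (F * F),
     (forall p, p \in s -> I p.1 /\ J p.2) /\ x = \sum_(p <- s) p.1 * p.2].

Definition principal (a : F) : set F :=
  [set x | exists r : R, x = FracField.tofrac r * a].

Lemma in_base0 : in_base 0.
Proof. by exists 0; rewrite tofrac0. Qed.

Lemma in_baseD x y : in_base x -> in_base y -> in_base (x + y).
Proof. by move=> [r ->] [s ->]; exists (r + s); rewrite tofracD. Qed.

Lemma in_baseM x y : in_base x -> in_base y -> in_base (x * y).
Proof. by move=> [r ->] [s ->]; exists (r * s); rewrite tofracM. Qed.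

Lemma dual_submodule I : submodule (dual I).
Proof.
split=> [y _|x y Ix Iy z Iz|r x Ix y Iy].
- by rewrite mul0r; apply: in_base0.
- by rewrite mulrDl; apply: in_baseD; [apply: Ix|apply: Iy].
- by rewrite -mulrA; apply: in_baseM (Ix _ Iy); exists r.
Qed.

Lemma sub_ddual I : I `<=` dual (dual I).
Proof. by move=> x Ix y dy; rewrite mulrC; apply: dy. Qed.

Lemma dual_ddual I : dual (dual (dual I)) = dual I.
Proof.
apply/seteqP; split; last exact: sub_ddual.
by move=> x dx y Iy; apply: dx; apply: sub_ddual.
Qed.

Lemma ddual_fractional I : fractional_ideal I -> fractional_ideal (dual (dual I)).
Proof.
move=> [_ [x Ix x0] [d d0 Id]]; split; first exact: dual_submodule.
  by exists x => //; apply: sub_ddual.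
exists d => // y dy; rewrite mulrC; apply: dy => z /Id.
by rewrite mulrC.
Qed.

Lemma ddual_divisorial I : fractional_ideal I -> divisorial (dual (dual I)).
Proof. by move=> fI; split; [apply: ddual_fractional|rewrite dual_ddual]. Qed.

Lemma ideal_mul_fractional I J :
  fractional_ideal I -> fractional_ideal J -> fractional_ideal (ideal_mul I J).
Proof.
move=> [[I0 ID IZ] [x Ix x0] [d d0 Id]] [_ [y Jy y0] [e e0 Je]].
split.
- split.
  + by exists [::]; rewrite big_nil.
  + move=> _ _ [s [sP ->]] [t [tP ->]]; exists (s ++ t).
    rewrite big_cat; split=> // p; rewrite mem_cat => /orP[]; first exact: sP.
    exact: tP.
  + move=> r _ [s [sP ->]].
    exists [seq (FracField.tofrac r * p.1, p.2) | p <- s]; split.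
      by move=> _ /mapP[p /sP[Ip Jp] ->] /=; split=> //; apply: IZ.
    by rewrite big_map mulr_sumr; apply: eq_bigr => p _ /=; rewrite mulrA.
- exists (x * y); last by rewrite mulf_neq0.
  exists [:: (x, y)]; rewrite big_seq1; split=> // p.
  by rewrite mem_seq1 => /eqP->.
- exists (d * e); first by rewrite mulf_neq0.
  move=> _ [s [sP ->]]; rewrite mulr_sumr big_seq.
  elim/big_ind: _ => [|? ?|p /sP[/Id ? /Je ?]]; [exact: in_base0|exact: in_baseD|].
  by rewrite tofracM mulrACA; apply: in_baseM.
Qed.

Lemma dual_mulP I J x :
  dual (ideal_mul I J) x <-> forall a b, I a -> J b -> in_base (x * (a * b)).
Proof.
split=> [dx a b Ia Jb|dx _ [s [sP ->]]].
  apply: dx; exists [:: (a, b)]; rewrite big_seq1; split=> // p.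
  by rewrite mem_seq1 => /eqP->.
rewrite mulr_sumr big_seq.
elim/big_ind: _ => [|? ?|p /sP[? ?]]; [exact: in_base0|exact: in_baseD|].
exact: dx.
Qed.

Lemma ideal_mulC I J : ideal_mul I J = ideal_mul J I.
Proof.
apply/seteqP; split=> _ [s [sP ->]]; exists [seq (p.2, p.1) | p <- s];
  (split; [by move=> _ /mapP[p /sP[? ?] ->]|
   by rewrite big_map; apply: eq_bigr => p _; rewrite mulrC]).
Qed.

Lemma dual_mul_ddl I J : dual (ideal_mul (dual (dual I)) J) = dual (ideal_mul I J).
Proof.
apply/seteqP; split=> x /dual_mulP dx; apply/dual_mulP => a b Ia Jb.
  by apply: dx => //; apply: sub_ddual.
rewrite [a * b]mulrC mulrA mulrC; apply: Ia => c Ic.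
by rewrite -mulrA [b * c]mulrC; apply: dx.
Qed.

Lemma dual_mulA I J K :
  dual (ideal_mul I (ideal_mul J K)) = dual (ideal_mul (ideal_mul I J) K).
Proof.
have mulP A B a b : A a -> B b -> ideal_mul A B (a * b).
  move=> Aa Bb; exists [:: (a, b)]; rewrite big_seq1; split=> // p.
  by rewrite mem_seq1 => /eqP->.
apply/seteqP; split=> x /dual_mulP dx; apply/dual_mulP => a b.
  move=> [s [sP ->]] Kb; rewrite mulr_suml mulr_sumr big_seq.
  elim/big_ind: _ => [|? ?|p /sP[? ?]]; [exact: in_base0|exact: in_baseD|].
  by rewrite -(mulrA p.1); apply: dx => //; apply: mulP.
move=> Ia [s [sP ->]]; rewrite mulr_sumr mulr_sumr big_seq.
elim/big_ind: _ => [|? ?|p /sP[? ?]]; [exact: in_base0|exact: in_baseD|].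
by rewrite (mulrA a); apply: dx => //; apply: mulP.
Qed.

Lemma in_principal a : principal a a.
Proof. by exists 1; rewrite tofrac1 mul1r. Qed.

Lemma dual_principal a : a != 0 -> dual (principal a) = principal a^-1.
Proof.
move=> a0; apply/seteqP; split=> x.
  by move=> /(_ a (in_principal a)) [r xa]; exists r; rewrite -xa mulfK.
by move=> [r ->] _ [s ->]; exists (r * s); rewrite mulrACA mulVf // mulr1 tofracM.
Qed.

Lemma fraction_denom (a : F) :
  exists2 d : R, d != 0 & in_base (FracField.tofrac d * a).
Proof.
elim/quotW: a => x; exists \d_x; first exact: denom_ratioP.
exists \n_x; rewrite !piE; apply/eqmodP.
rewrite /= FracField.equivfE /FracField.mulf !numden_Ratio ?oner_eq0 ?mul1r //.
by rewrite mulr1 mulrC.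
all: exact: denom_ratioP.
Qed.

Lemma principal_divisorial a : a != 0 -> divisorial (principal a).
Proof.
move=> a0; split; last by rewrite !dual_principal ?invr_neq0 ?invrK.
split.
- split.
  + by exists 0; rewrite tofrac0 mul0r.
  + by move=> _ _ [r ->] [s ->]; exists (r + s); rewrite tofracD mulrDl.
  + by move=> r _ [s ->]; exists (r * s); rewrite tofracM mulrA.
- by exists a => //; apply: in_principal.
- have [d d0 da] := fraction_denom a; exists d => // _ [r ->].
  by rewrite mulrCA; apply: in_baseM da; exists r.
Qed.

Lemma dual_mul_principal a b : a != 0 -> b != 0 ->
  dual (dual (ideal_mul (principal a) (principal b))) = principal (a * b).
Proof.
move=> a0 b0.
suff -> : dual (ideal_mul (principal a) (principal b)) = principal (a * b)^-1.
  by rewrite dual_principal ?invr_neq0 ?mulf_neq0 ?invrK.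
rewrite -dual_principal ?mulf_neq0 //.
apply/seteqP; split=> x.
  move=> /dual_mulP dx _ [r ->]; rewrite mulrCA; apply: in_baseM; first by exists r.
  by apply: dx; apply: in_principal.
move=> dx; apply/dual_mulP => _ _ [r ->] [s ->].
by apply: dx; exists (r * s); rewrite mulrACA tofracM.
Qed.

(* The group of divisors of R: divisorial fractional ideals, with the law
   I + J := (R : (R : I J)).  It is an abelian monoid for every domain R, and a
   group exactly when R is completely integrally closed, in particular when R is
   Noetherian and normal. *)
Record divisor := Divisor {
  divisor_ideal :> set F;
  divisorP : divisorial divisor_ideal }.

HB.instance Definition _ := gen_eqMixin divisor.
HB.instance Definition _ := gen_choiceMixin divisor.

Lemma divisor_inj (I J : divisor) : (I : set F) = J -> I = J.
Proof.
case: I J => [I dI] [J dJ] /= eIJ; case: J / eIJ dJ => dJ.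
by congr Divisor; apply: Prop_irrelevance.
Qed.

Definition divisor_add (I J : divisor) : divisor :=
  Divisor (ddual_divisorial (ideal_mul_fractional (divisorP I).1 (divisorP J).1)).

Definition principal_divisor (a : F) (a0 : a != 0) : divisor :=
  Divisor (principal_divisorial a0).

Definition divisor0 : divisor := principal_divisor (oner_neq0 F).

Lemma divisor_addC : commutative divisor_add.
Proof. by move=> I J; apply: divisor_inj; rewrite /= ideal_mulC. Qed.

Lemma divisor_addA : associative divisor_add.
Proof.
move=> I J K; apply: divisor_inj => /=.
by rewrite dual_mul_ddl ideal_mulC dual_mul_ddl ideal_mulC dual_mulA.
Qed.

Lemma divisor_add0 : left_id divisor0 divisor_add.
Proof.
move=> I; apply: divisor_inj => /=; have [[[_ _ IZ] _ _] <-] := divisorP I.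
congr dual; apply/seteqP; split=> x.
  move=> /dual_mulP dx y Iy; rewrite -[y]mul1r; apply: dx; first exact: in_principal.
  exact: sub_ddual.
move=> dx; apply/dual_mulP => _ y [r ->] ddy; rewrite mulr1 mulrCA [x * y]mulrC.
by apply: in_baseM; [exists r|apply: ddy].
Qed.

HB.instance Definition _ :=
  GRing.isNmodule.Build divisor divisor_addA divisor_addC divisor_add0.

Lemma principal_divisorD a b (a0 : a != 0) (b0 : b != 0) :
  principal_divisor a0 + principal_divisor b0 = principal_divisor (mulf_neq0 a0 b0).
Proof. by apply: divisor_inj; rewrite /= dual_mul_principal. Qed.

Lemma principal_divisorN a (a0 : a != 0) :
  principal_divisor a0 + principal_divisor (invr_neq0 a0) = 0.
Proof. by apply: divisor_inj; rewrite /= dual_mul_principal ?invr_neq0 // mulfV. Qed.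

Definition lin_equiv : rel divisor := fun I J =>
  `[< exists (a : F) (a0 : a != 0), I = J + principal_divisor a0 >].

Lemma lin_equiv_refl : reflexive lin_equiv.
Proof. by move=> I; apply/asboolP; exists 1, (oner_neq0 F); rewrite [RHS]addr0. Qed.

Lemma lin_equiv_sym : ssrbool.symmetric lin_equiv.
Proof.
suff sym I J : lin_equiv I J -> lin_equiv J I by move=> I J; apply/idP/idP; apply: sym.
move=> /asboolP[a [a0 ->]]; apply/asboolP; exists a^-1, (invr_neq0 a0).
by rewrite -addrA principal_divisorN addr0.
Qed.

Lemma lin_equiv_trans : transitive lin_equiv.
Proof.
move=> J I K /asboolP[a [a0 ->]] /asboolP[b [b0 ->]]; apply/asboolP.
by exists (b * a), (mulf_neq0 b0 a0); rewrite -addrA principal_divisorD.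
Qed.

Canonical lin_equiv_equiv :=
  EquivRel lin_equiv lin_equiv_refl lin_equiv_sym lin_equiv_trans.

Definition class_group := {eq_quot lin_equiv}.
HB.instance Definition _ := Choice.on class_group.
HB.instance Definition _ : EqQuotient _ lin_equiv class_group :=
  EqQuotient.on class_group.

Definition class_zero : class_group := \pi_class_group 0.
Definition class_add (x y : class_group) : class_group :=
  \pi_class_group (repr x + repr y).

Lemma lin_equivD (I I' J J' : divisor) :
  lin_equiv I I' -> lin_equiv J J' -> lin_equiv (I + J) (I' + J').
Proof.
move=> /asboolP[a [a0 ->]] /asboolP[b [b0 ->]]; apply/asboolP.
by exists (a * b), (mulf_neq0 a0 b0); rewrite addrACA principal_divisorD.
Qed.

Lemma class_eqE (I J : divisor) :
  (\pi_class_group I == \pi_class_group J) = lin_equiv I J.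
Proof. by rewrite eqmodE. Qed.

Lemma pi_class_add (I J : divisor) :
  \pi_class_group (I + J) = class_add (\pi_class_group I) (\pi_class_group J).
Proof.
by apply/eqP; rewrite class_eqE; apply: lin_equivD; rewrite -class_eqE reprK.
Qed.

Lemma class_addA : associative class_add.
Proof.
move=> x y z; rewrite -[x]reprK -[y]reprK -[z]reprK.
rewrite -(pi_class_add (repr y)) -(pi_class_add (repr x) (repr y)).
by rewrite -(pi_class_add (repr x)) -(pi_class_add (repr x + repr y)) addrA.
Qed.

Lemma class_addC : commutative class_add.
Proof. by move=> x y; rewrite /class_add addrC. Qed.

Lemma class_add0 : left_id class_zero class_add.
Proof. by move=> x; rewrite -[x]reprK -pi_class_add add0r. Qed.

HB.instance Definition _ :=
  GRing.isNmodule.Build class_group class_addA class_addC class_add0.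

End Divisors.

(* M is only assumed to be a monoid; being isomorphic to Z^r forces it to be a group. *)
Definition free_abelian_of_rank (M : nmodType) (r : nat) : Prop :=
  exists f : {additive M -> 'rV[int]_r}, bijective f.

(* A simple graph on the vertex set 'I_n, i.e. [n] shifted by one. *)
Record sgraph (n : nat) := SGraph {
  edges :> {set {set 'I_n}};
  card_edges : forall e, e \in edges -> #|e| = 2 }.

Definition degree n (G : sgraph n) (i : 'I_n) : nat := #|[set e in edges G | i \in e]|.

Section DiagonalMinors.
Variables (K : fieldType) (n : nat) (G : sgraph n).
Local Notation S := {mpoly K[n * n]}.

Definition xvar (i j : 'I_n) : S := 'X_(mxvec_index i j).

Definition diag_minor (i j : 'I_n) : S :=
  xvar i i * xvar j j - xvar i j * xvar j i.

Definition PG : S -> bool := fun f =>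
  `[< exists c : 'I_n -> 'I_n -> S,
        f = \sum_(i < n) \sum_(j < n | (i < j)%N && ([set i; j] \in edges G))
              c i j * diag_minor i j >].

Definition adj (i j : 'I_n) := [set i; j] \in edges G.

Lemma adjC i j : adj i j = adj j i. Proof. by rewrite /adj finset.setUC. Qed.

Lemma adj_irr i : adj i i = false.
Proof. by apply/negP => /card_edges; rewrite finset.setUid cards1. Qed.

Lemma PG0 : PG 0.
Proof.
apply/asboolP; exists (fun _ _ => 0).
by rewrite big1 // => i _; rewrite big1 // => j _; rewrite mul0r.
Qed.

Lemma PGMD a u v : PG u -> PG v -> PG (a * u + v).
Proof.
move=> /asboolP[c ->] /asboolP[d ->]; apply/asboolP.
exists (fun i j => a * c i j + d i j).
rewrite mulr_sumr -big_split; apply: eq_bigr => i _ /=.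
rewrite mulr_sumr -big_split; apply: eq_bigr => j _ /=.
by rewrite mulrDl mulrA.
Qed.

Lemma PGM a u : PG u -> PG (a * u).
Proof. by move=> Pu; rewrite -[_ * _]addr0; apply: PGMD PG0. Qed.

Lemma PGD u v : PG u -> PG v -> PG (u + v).
Proof. by move=> Pu Pv; rewrite -[u]mul1r; apply: PGMD. Qed.

Lemma diag_minorC i j : diag_minor j i = diag_minor i j.
Proof. by rewrite /diag_minor [xvar j j * _]mulrC [xvar j i * _]mulrC. Qed.

Lemma PG_gen i j : [set i; j] \in edges G -> PG (diag_minor i j).
Proof.
rewrite -/(adj i j); wlog lt_ij : i j / (i < j)%N => [wlg aij|aij].
  case: (ltngtP i j) => [ltij|ltji|eqij]; first exact: wlg.
    by rewrite -diag_minorC; apply: wlg; rewrite // adjC.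
  by move: aij; rewrite (ord_inj eqij) adj_irr.
apply/asboolP; exists (fun a b => ((a == i) && (b == j))%:R).
rewrite (bigD1 i) //= (bigD1 j) /=; last by rewrite lt_ij.
rewrite !eqxx mul1r !big1 ?addr0 // => [a /negPf ->|b /andP[_ /negPf ->]].
  by rewrite big1 // => b _; rewrite mul0r.
by rewrite andbF mul0r.
Qed.

(* P_G is prime: it is the kernel of the monomial substitution (toric_subst)
   x_ii |-> D_i,  x_ij |-> D_i y_ij,  x_ji |-> D_j / y_ij  for edges i < j,
   x_ij |-> y_ij for the other i <> j,
   where D_i = y_ii \prod_(k < i, k ~ i) y_ki. *)

Local Notation at_ m i j := ((m : 'X_{1.. n * n}) (mxvec_index i j)).

Definition rowsum (m : 'X_{1.. n * n}) a : nat := \sum_(b < n | (b == a) || adj a b) at_ m a b.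

Definition expo_entry (m : 'X_{1.. n * n}) (a b : 'I_n) : nat :=
  if a == b then rowsum m a
  else if ~~ adj a b then at_ m a b
  else if (a < b)%N then (rowsum m b + at_ m a b - at_ m b a)%N else 0%N.

Definition expo (m : 'X_{1.. n * n}) : 'X_{1.. n * n} :=
  [multinom mxvec (\matrix_(a, b) expo_entry m a b) 0%R k | k < (n * n)].

Lemma expoE m a b : at_ (expo m) a b = expo_entry m a b.
Proof. by rewrite mnmE mxvecE mxE. Qed.

Lemma mnm_ext (m1 m2 : 'X_{1.. n * n}) : (forall a b, at_ m1 a b = at_ m2 a b) -> m1 = m2.
Proof. by move=> e; apply/mnmP => k; case/mxvec_indexP: k => a b; apply: e. Qed.

Lemma le_rowsum m a b : adj a b -> (at_ m a b <= rowsum m a)%N.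
Proof. by move=> ab; rewrite /rowsum (bigD1 b) ?ab ?orbT //= leq_addr. Qed.

Lemma rowsumD m1 m2 a : rowsum (m1 + m2)%MM a = (rowsum m1 a + rowsum m2 a)%N.
Proof. by rewrite -big_split; apply: eq_bigr => b _; rewrite mnmDE. Qed.

Lemma expoD m1 m2 : expo (m1 + m2)%MM = (expo m1 + expo m2)%MM.
Proof.
apply: mnm_ext => a b; rewrite mnmDE !expoE /expo_entry.
case: eqP => [_|/eqP neq_ab]; first exact: rowsumD.
case: ifPn => [_|/negbNE ab]; first by rewrite mnmDE.
case: ifP => // _; rewrite rowsumD !mnmDE.
have := @le_rowsum m1 b a; have := @le_rowsum m2 b a; rewrite adjC ab.
move=> /(_ isT) h2 /(_ isT) h1; lia.
Qed.

Lemma expo0 : expo 0%MM = 0%MM.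
Proof.
have := expoD 0%MM 0%MM; rewrite addm0 => e; apply/mnmP => k; rewrite mnm0E.
move/mnmP/(_ k): e; rewrite mnmDE; lia.
Qed.

Lemma idx_eq (i j a b : 'I_n) : (mxvec_index i j == mxvec_index a b) = (i == a) && (j == b).
Proof.
apply/eqP/andP => [e|[/eqP-> /eqP->] //].
have [g gK _] := curry_mxvec_bij n n.
have := congr1 g e.
rewrite -[mxvec_index i j]/(uncurry (@mxvec_index n n) (i, j)).
rewrite -[mxvec_index a b]/(uncurry (@mxvec_index n n) (a, b)).
by rewrite !gK ?inE // => -[-> ->].
Qed.

Definition Umx (i j : 'I_n) : 'X_{1.. n * n} := U_(mxvec_index i j)%MM.

Lemma UE i j a b : at_ (Umx i j) a b = ((i == a) && (j == b)) :> nat.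
Proof. by rewrite mnm1E idx_eq. Qed.

Lemma rowsumU i j a : (i == j) || adj i j -> rowsum (Umx i j) a = (i == a).
Proof.
move=> ij; rewrite /rowsum; have [<-|neq_ia] := eqVneq i a; last first.
  by rewrite big1 // => b _; rewrite UE (negPf neq_ia).
rewrite (bigD1 j) /=; last by rewrite eq_sym.
rewrite UE !eqxx big1 // => b /andP[_ /negPf nb].
by rewrite UE eqxx eq_sym nb.
Qed.

Lemma expo_swap i j : adj i j -> expo (Umx i i + Umx j j)%MM = expo (Umx i j + Umx j i)%MM.
Proof.
move=> ij; have neq_ij : i != j by apply: contraTneq ij => ->; rewrite adj_irr.
have rs a : rowsum (Umx i i + Umx j j)%MM a = rowsum (Umx i j + Umx j i)%MM a.
  by rewrite !rowsumD !rowsumU ?eqxx // ?ij ?orbT // adjC ij orbT.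
apply: mnm_ext => a b; rewrite !expoE /expo_entry rs.
case: eqVneq => [//|neq_ab]; case: ifPn => nab.
  rewrite !mnmDE !UE.
  have [eia|_] := eqVneq i a; have [ejb|_] := eqVneq j b.
  - by move: nab; rewrite -eia -ejb ij.
  - have [eja|_] := eqVneq j a; first by move: neq_ij; rewrite eia eja eqxx.
    by have [eib|_] := eqVneq i b; first by move: neq_ab; rewrite -eia eib eqxx.
  - have [eja|_] := eqVneq j a; first by move: neq_ab; rewrite -eja ejb eqxx.
    by [].
  - have [eja|_] := eqVneq j a; have [eib|_] := eqVneq i b => //.
    by move: nab; rewrite -eja -eib adjC ij.
case: ifP => // _; rewrite rs !mnmDE !UE.
have z c : (c == a) && (c == b) = false.
  by apply: contraNF neq_ab => /andP[/eqP<- /eqP<-].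
rewrite [(i == b) && (i == a)]andbC [(j == b) && (j == a)]andbC !z.
rewrite [(i == b) && _]andbC [(j == b) && _]andbC; lia.
Qed.

Definition toric_subst : S -> S := mmap (@mpolyC _ K) (fun k => 'X_[expo U_(k)]).

Lemma substX m : toric_subst 'X_[m] = 'X_[expo m].
Proof.
rewrite /toric_subst mmapX /mmap1 {2}[m]multinomUE_id.
rewrite (big_morph expo expoD expo0).
rewrite (big_morph (fun m => 'X_[m] : S) (@mpolyXD _ _) (@mpolyX0 _ _)); apply: eq_bigr => k _.
rewrite mpolyXn; congr 'X_[_].
by elim: (m k) => [|p IHp]; rewrite ?mulm0n ?expo0 // !mulmS expoD IHp.
Qed.

Lemma subst_minor i j : adj i j -> toric_subst (diag_minor i j) = 0.
Proof.
move=> ij; rewrite /diag_minor /xvar -!mpolyXD /toric_subst rmorphB /= -/toric_subst.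
by rewrite !substX expo_swap // subrr.
Qed.

Lemma subst_PG f : PG f -> toric_subst f = 0.
Proof.
move=> /asboolP[c ->]; rewrite /toric_subst rmorph_sum big1 //= => i _.
rewrite rmorph_sum big1 //= => j /andP[_ ij].
by rewrite rmorphM /= -/toric_subst subst_minor ?mulr0.
Qed.

Definition standard (m : 'X_{1.. n * n}) :=
  forall a b, adj a b -> (at_ m a b == 0%N) || (at_ m b a == 0%N).

Definition offdiag (m : 'X_{1.. n * n}) : nat := \sum_(a < n) \sum_(b < n | b != a) at_ m a b.

Lemma offdiagD m1 m2 : offdiag (m1 + m2)%MM = (offdiag m1 + offdiag m2)%N.
Proof.
rewrite -big_split; apply: eq_bigr => a _; rewrite -big_split.
by apply: eq_bigr => b _; rewrite mnmDE.
Qed.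

Lemma to_standard m : exists s, standard s /\ PG ('X_[m] - 'X_[s]).
Proof.
have [N] := ubnP (offdiag m); elim: N m => // N IHN m ltmN.
have [std|] := pselect (standard m).
  by exists m; rewrite subrr; split => //; apply: PG0.
move=> /existsNP[i /existsNP[j /not_implyP[ij /negP]]].
rewrite negb_or -!lt0n => /andP[mij mji].
have neq_ij : i != j by apply: contraTneq ij => ->; rewrite adj_irr.
have leUm : (Umx i j + Umx j i <= m)%MM.
  apply/mnm_lepP => k; case/mxvec_indexP: k => a b; rewrite mnmDE !UE.
  have [<-|_] := eqVneq i a; have [<-|_] := eqVneq j b => //=.
  - by rewrite [j == i]eq_sym (negPf neq_ij).
  - have [eji|_] := eqVneq j i => //=; first by rewrite eji eqxx in neq_ij.
  - by have [eji|_] := eqVneq i j => //=; [rewrite eji eqxx in neq_ij|rewrite andbF].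
  - by have [<-|_] := eqVneq j a; have [<-|_] := eqVneq i b.
have [r def_m] : exists r, m = (r + (Umx i j + Umx j i))%MM.
  by exists (m - (Umx i j + Umx j i))%MM; rewrite submK.
have [s [std Ps]] : exists s, standard s /\ PG ('X_[r + (Umx i i + Umx j j)%MM] - 'X_[s]).
  apply: IHN; rewrite -ltnS; apply: leq_trans ltmN.
  rewrite def_m !offdiagD ltnS ltn_add2l.
  have -> : offdiag (Umx i i) = 0%N.
    by apply: big1 => a _; apply: big1 => b /negPf nb; rewrite UE;
      have [->|//] := eqVneq i a; rewrite eq_sym nb.
  have -> : offdiag (Umx j j) = 0%N.
    by apply: big1 => a _; apply: big1 => b /negPf nb; rewrite UE;
      have [->|//] := eqVneq j a; rewrite eq_sym nb.
  rewrite addn0 (leq_trans _ (leq_addr _ _)) // /offdiag (bigD1 i) //=.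
  by rewrite (bigD1 j) 1?eq_sym //= UE !eqxx.
exists s; split => //.
rewrite -['X_[m]](subrK 'X_[r + (Umx i i + Umx j j)]) -addrA; apply: PGD => //.
rewrite def_m !mpolyXD -mulrBr; apply: PGM.
have := PGM (-1) (PG_gen ij); rewrite mulN1r opprB.
by rewrite /diag_minor /xvar -!mpolyXD.
Qed.

Lemma expo_inj_standard s t : standard s -> standard t -> expo s = expo t -> s = t.
Proof.
move=> std_s std_t e; have ee a b : expo_entry s a b = expo_entry t a b.
  by rewrite -!expoE e.
have rs a : rowsum s a = rowsum t a by have := ee a a; rewrite /expo_entry eqxx.
have lt_adj a b : adj a b -> (a < b)%N -> at_ s a b = at_ t a b /\ at_ s b a = at_ t b a.
  move=> ab lt_ab; have := ee a b; rewrite /expo_entry ab lt_ab rs.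
  rewrite -val_eqE /= ltn_eqF //=.
  have := std_s a b ab; have := std_t a b ab.
  have := @le_rowsum s b a; have := @le_rowsum t b a.
  rewrite adjC ab rs => /(_ isT) h1 /(_ isT) h2; lia.
have offd a b : a != b -> at_ s a b = at_ t a b.
  move=> neq_ab; have := ee a b; rewrite /expo_entry (negPf neq_ab).
  case: ifPn => // /negbNE ab _.
  case: (ltngtP a b) => [lab|lba|eab]; first by case: (lt_adj a b).
    by case: (lt_adj b a); rewrite // adjC.
  by rewrite (ord_inj eab) eqxx in neq_ab.
apply: mnm_ext => a b; have [<-|/offd //] := eqVneq a b.
have := rs a; rewrite /rowsum (bigD1 a) ?eqxx //= [in RHS](bigD1 a) ?eqxx //=.
rewrite (eq_bigr (fun b => at_ t a b)); first by move/addIn.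
by move=> c /andP[_ nc]; apply: offd; rewrite eq_sym.
Qed.

Lemma PG_ker f : toric_subst f = 0 -> PG f.
Proof.
have [nf nfP] := choice to_standard => f0.
pose g := \sum_(m <- msupp f) f@_m *: 'X_[nf m].
have expo_nf m : expo (nf m) = expo m.
  have [_ /subst_PG] := nfP m; rewrite /toric_subst rmorphB /= -/toric_subst !substX.
  move/subr0_eq/(congr1 (mcoeff (expo m))); rewrite !mcoeffX eqxx.
  by have [//|_ /eqP] := eqVneq (expo (nf m)) (expo m); rewrite oner_eq0.
have -> : f = f - g + g by rewrite subrK.
apply: PGD.
  rewrite {1}[f]mpolyE -sumrB.
  elim/big_ind: _ => [||m _]; [exact: PG0|by move=> *; apply: PGD|].
  by rewrite -scalerBr -mul_mpolyC; apply: PGM; case: (nfP m).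
suff -> : g = 0 by exact: PG0.
apply/mpolyP => t; rewrite mcoeff0 raddf_sum /=.
have [std_t|nstd_t] := pselect (standard t); last first.
  rewrite big1 // => m _; rewrite mcoeffZ mcoeffX.
  have [e|_] := eqVneq (nf m) t; last by rewrite mulr0.
  by case: nstd_t; rewrite -e; case: (nfP m).
move/(congr1 (mcoeff (expo t))): f0; rewrite mcoeff0 {1}[f]mpolyE /toric_subst.
rewrite rmorph_sum raddf_sum /= => f0; rewrite -[RHS]f0.
apply: eq_bigr => m _; rewrite mmapZ -/toric_subst substX mul_mpolyC !mcoeffZ !mcoeffX.
congr (_ * (nat_of_bool _)%:R); apply/eqP/eqP => [<-|e]; first by rewrite expo_nf.
apply: expo_inj_standard => //; first by case: (nfP m).
by rewrite expo_nf.
Qed.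

Lemma PG_idealr_closed : idealr_closed PG.
Proof.
split; first exact: PG0; last by move=> a u v; apply: PGMD.
by apply/negP => /subst_PG/eqP; rewrite /toric_subst rmorph1 oner_eq0.
Qed.

Lemma PG_prime : prime_idealr_closed PG.
Proof.
move=> u v /subst_PG/eqP; rewrite /toric_subst rmorphM mulf_eq0 -/toric_subst.
by move=> /orP[] /eqP /PG_ker Pu; apply/orP; [left|right].
Qed.

HB.instance Definition _ := isIdealr.Build S PG PG_idealr_closed.
HB.instance Definition _ := isPrimeIdealrClosed.Build S PG PG_prime.

Definition RG := {ideal_quot (PG : idealr S)}.

HB.instance Definition _ := GRing.ComNzRing.on RG.

Definition RG_inv (x : RG) : RG :=
  if pselect (exists y, y * x = 1) is left yx then sval (cid yx) else x.

Definition RG_unit : pred RG := fun x => `[< exists y, y * x = 1 >].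

Lemma RG_mulVx : {in RG_unit, left_inverse 1 RG_inv *%R}.
Proof.
move=> x /asboolP yx; rewrite /RG_inv; case: pselect => // h.
by case: (cid h).
Qed.

Lemma RG_unitP (x y : RG) : y * x = 1 -> RG_unit x.
Proof. by move=> yx; apply/asboolP; exists y. Qed.

Lemma RG_inv_out : {in [predC RG_unit], RG_inv =1 id}.
Proof.
move=> x; rewrite inE => /asboolP nx; rewrite /RG_inv.
by case: pselect.
Qed.

HB.instance Definition _ :=
  GRing.ComNzRing_hasMulInverse.Build RG RG_mulVx RG_unitP RG_inv_out.

Lemma RG_integral : GRing.integral_domain_axiom RG.
Proof. exact: Quotient.rquot_IdomainAxiom. Qed.

HB.instance Definition _ := GRing.ComUnitRing_isIntegral.Build RG RG_integral.

End DiagonalMinors.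

(* Main.v *)
(* RG is the semigroup ring of a normal affine semigroup.  Inverting all monomials turns it
   into a Laurent polynomial ring B, which is factorial, and RG is the set of x in B with
   v_f x >= 0 for the monomial valuations v_f of the facets f.  Hence every divisorial ideal
   is {x in g B | v_f x >= m_f for all f} with g unique up to a unit of B, and
   (g, m) |-> m - v g identifies Cl(RG) with the cokernel of the map sending a monomial
   (i.e. a unit of B, up to a constant) to its vector of facet values.
   The facets are (i, T) with T a set of neighbours of i, of value
     u_ii + sum_(j in T) u_ij + sum_(j ~ i, j notin T) u_ji
   on a monomial with exponents u, and the non-edges (k, l), of value u_kl.  Since
     (i, T)(u) = (i, {})(u) + sum_(j in T) (u_ij - u_ji),
   the values at (i, {}), at (i, {j}) with i < j, and at the non-edges are arbitrary and
   determine all the others; so the cokernel is free on the remaining facets, of which there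
   are sum_i 2^deg(i) - n - |E|. *)
Require Import Defs.
From HB Require Import structures.
From mathcomp Require Import all_boot all_order all_algebra.
From mathcomp Require Import boolp classical_sets.
From mathcomp Require Import mpoly zify ring.

Set Implicit Arguments.
Unset Strict Implicit.
Unset Printing Implicit Defensive.

Import Order.TTheory GRing.Theory Num.Theory.
Local Open Scope ring_scope.

(** * Polynomial rings over factorial domains *)

Section Factorial.

(** The valuations come from weights: if w_ii + w_jj = w_ij + w_ji on every edge, both terms of each
    binomial acquire the same power of t in the toric parametrization twisted by [w], and v_f is the
    order in t, extended to fractions. The delicate point is the uniqueness of (g, m): every
    prescribed m must be the vector of minima actually attained on the ideal that it defines. This
    rests on a monomial of value 0 at one given facet and of positive value at all others: its
    powers raise the other values at will without disturbing the given one. B is handled as a subset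
    of the fraction field of [RG], namely the localization at the monomials of the polynomial ring
    in the variables that remain once x_ji = x_ii x_jj / x_ij eliminates one variable per edge;
    Gauss's lemma makes that polynomial ring factorial. Normality is used on exponents: if s - m is
    nonnegative at all facets, then the monomial of s is a multiple of that of m in [RG]. *)

Definition rdvd (A : idomainType) (a b : A) := exists c, b = a * c.

Definition prime_elt (A : idomainType) (p : A) :=
  [/\ p != 0, p \isn't a GRing.unit
    & forall a b, rdvd p (a * b) -> rdvd p a \/ rdvd p b].

Definition factorization (A : idomainType) (a u : A) (s : seq A) :=
  [/\ u \is a GRing.unit, forall p, p \in s -> prime_elt p & a = u * \prod_(p <- s) p].

(** The factors are primes rather than irreducibles, so uniqueness of factorization is built in. *)
Definition factorial (A : idomainType) :=
  forall a : A, a != 0 -> exists u s, factorization a u s.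

Lemma unit_neq0 (A : unitRingType) (u : A) : u \is a GRing.unit -> u != 0.
Proof. by apply: contraTneq => ->; rewrite unitr0. Qed.

Lemma factorizationM (A : idomainType) (a b u v : A) s t :
  factorization a u s -> factorization b v t -> factorization (a * b) (u * v) (s ++ t).
Proof.
move=> [uu ps ->] [vu pt ->]; split; first by rewrite unitrM uu.
  by move=> p; rewrite mem_cat => /orP[/ps|/pt].
by rewrite big_cat mulrACA.
Qed.

(** If p divides a prime q = p x of the list, then q divides p or x; the latter would make p a unit,
    so x is a unit and joins the unit factor. The shorter list drives the induction on content. *)
Lemma prime_factor_cancel (A : idomainType) (p u : A) s :
  prime_elt p -> u \is a GRing.unit -> (forall q, q \in s -> prime_elt q) ->
  rdvd p (u * \prod_(q <- s) q) ->
  exists v t, [/\ (size t < size s)%N, v \is a GRing.unit,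
    forall q, q \in t -> prime_elt q & u * \prod_(q <- s) q = p * (v * \prod_(q <- t) q)].
Proof.
move=> [p0 pu pP] uu; elim: s => [_|q s IHs sP].
  by rewrite big_nil mulr1 => -[c eu]; move: uu; rewrite eu unitrM (negPf pu).
have sP' r : r \in s -> prime_elt r by move=> rs; apply: sP; rewrite inE rs orbT.
rewrite big_cons mulrCA => /pP[[x eq]|/(IHs sP')[v [t [lts vu tP e]]]]; last first.
  exists v, (q :: t); rewrite big_cons e; split => //; last by ring.
  by move=> r; rewrite inE => /orP[/eqP->|/tP //]; apply: sP; rewrite mem_head.
have [q0 qu qP] : prime_elt q by apply: sP; rewrite mem_head.
have xu : x \is a GRing.unit.
  have /qP[[z ez]|[z ez]] : rdvd q (p * x) by exists 1; rewrite mulr1.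
    by apply/unitrPr; exists z; apply: (mulfI q0); rewrite mulr1 {2}eq ez; ring.
  by case/negP: pu; apply/unitrPr; exists z; apply: (mulfI q0); rewrite mulr1 {2}eq ez; ring.
by exists (u * x), s; split => //; rewrite ?unitrM ?uu // eq; ring.
Qed.

Variable A : idomainType.
Hypothesis facA : factorial A.
Implicit Types (f g h q : {poly A}) (p c u : A).

Lemma rdvd_polyC p f : rdvd p%:P f <-> forall i, rdvd p f`_i.
Proof.
split=> [[g ->] i|pf]; first by exists g`_i; rewrite coefCM.
have [g gP] := choice pf; exists (\poly_(i < size f) g i).
apply/polyP => i; rewrite coefCM coef_poly; case: ltnP => // le_fi.
by rewrite mulr0 nth_default.
Qed.

Lemma rdvdD (B : idomainType) (a b c : B) : rdvd a b -> rdvd a c -> rdvd a (b + c).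
Proof. by move=> [x ->] [y ->]; exists (x + y); rewrite mulrDr. Qed.

Lemma rdvdMr (B : idomainType) (a b c : B) : rdvd a b -> rdvd a (b * c).
Proof. by move=> [x ->]; exists (x * c); rewrite mulrA. Qed.

Lemma rdvdMl (B : idomainType) (a b c : B) : rdvd a b -> rdvd a (c * b).
Proof. by rewrite mulrC; apply: rdvdMr. Qed.

Lemma rdvd_sum (B : idomainType) (I : Type) (r : seq I) (P : pred I) (a : B) (F : I -> B) :
  (forall i, P i -> rdvd a (F i)) -> rdvd a (\sum_(i <- r | P i) F i).
Proof.
by move=> aF; elim/big_ind: _ => //; [exists 0; rewrite mulr0 | move=> *; apply: rdvdD].
Qed.

(** Gauss's lemma: with f_i and g_j the first coefficients not divisible by p, the coefficient of
    index i + j of f g is f_i g_j plus multiples of p. *)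
Lemma prime_polyC p : prime_elt p -> prime_elt p%:P.
Proof.
move=> [p0 pu pP]; split; first by rewrite polyC_eq0.
  by rewrite poly_unitE size_polyC p0 coefC eqxx (negPf pu).
move=> f g /rdvd_polyC pfg.
have [|/(contra_not (rdvd_polyC p f).2)/existsNP nf] := pselect (rdvd p%:P f); first by left.
have [|/(contra_not (rdvd_polyC p g).2)/existsNP ng] := pselect (rdvd p%:P g); first by right.
exfalso.
have {}nf : exists i, `[< ~ rdvd p f`_i >] by case: nf => i ?; exists i; apply/asboolP.
have {}ng : exists i, `[< ~ rdvd p g`_i >] by case: ng => i ?; exists i; apply/asboolP.
case: (ex_minnP nf) => i /asboolP pi minf.
case: (ex_minnP ng) => j /asboolP pj ming.
have ltf k : (k < i)%N -> rdvd p f`_k.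
  by move=> lt; apply: contrapT => /asboolP /minf; rewrite leqNgt lt.
have ltg k : (k < j)%N -> rdvd p g`_k.
  by move=> lt; apply: contrapT => /asboolP /ming; rewrite leqNgt lt.
have := pfg (i + j)%N; rewrite coefM.
have lti : (i < (i + j).+1)%N by rewrite ltnS leq_addr.
rewrite (bigD1 (Ordinal lti)) //= addKn => pS.
have : rdvd p (f`_i * g`_j).
  rewrite -[_ * _](addrK (\sum_(k < (i + j).+1 | k != Ordinal lti) f`_k * g`_(i + j - k))).
  apply: rdvdD => //; rewrite -mulrN1; apply/rdvdMr/rdvd_sum => k.
  rewrite -val_eqE /= neq_ltn => /orP[lt|lt]; first exact/rdvdMr/ltf.
  by apply/rdvdMl/ltg; have := ltn_ord k; lia.
by move=> /pP[].
Qed.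

Definition primitive f := forall p, prime_elt p -> ~ rdvd p%:P f.

(** A prime constant dividing f also divides its leading coefficient, so the number of prime factors
    of the latter drops with each extraction. *)
Lemma extract_content f : f != 0 -> exists c g, [/\ c != 0, primitive g & f = c%:P * g].
Proof.
move=> f0; have /facA[u [s [uu sP e]]] : lead_coef f != 0 by rewrite lead_coef_eq0.
have [N] := ubnP (size s); elim: N f f0 u s uu sP e => // N IHN f f0 u s uu sP e ltsN.
have [prim|] := pselect (primitive f); first by exists 1, f; rewrite mul1r oner_neq0.
move=> /existsNP[p /not_implyP[pP /contrapT[g ef]]].
have [p0 _ _] := pP.
have pl : rdvd p (u * \prod_(q <- s) q).
  by rewrite -e ef lead_coefM lead_coefC; exists (lead_coef g).
have [v [t [ltts vu tP e']]] := prime_factor_cancel pP uu sP pl.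
have g0 : g != 0 by apply: contraNneq f0 => g0; rewrite ef g0 mulr0.
have [||c [h [c0 hprim eg]]] := IHN g g0 v t vu tP.
- by apply: (mulfI p0); rewrite -e' -e ef lead_coefM lead_coefC.
- exact: leq_trans ltts ltsN.
by exists (p * c), h; rewrite mulf_neq0 // polyCM -mulrA -eg.
Qed.

(** The primes of c are removed one at a time: each stays prime as a constant and divides f q but
    not f, hence divides q. *)
Lemma primitive_cancel c f g q :
  c != 0 -> primitive f -> c%:P * g = f * q -> rdvd f g.
Proof.
move=> /facA[u [s [uu sP ->]]] prim; elim: s sP q => [_|p s IHs sP] q.
  rewrite big_nil mulr1 => e; exists (u^-1%:P * q).
  by rewrite mulrCA -e mulrA -polyCM mulVr // mul1r.
rewrite big_cons => e; have pP : prime_elt p by apply: sP; rewrite mem_head.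
have pP' := prime_polyC pP.
have [p0 _ pd] := pP'.
have /pd[|[q' eq]] : rdvd p%:P (f * q).
- by rewrite -e; exists ((u * \prod_(r <- s) r)%:P * g); rewrite !polyCM; ring.
- by move=> /(prim _ pP).
apply: (IHs _ q'); first by move=> r rs; apply: sP; rewrite inE rs orbT.
by apply: (mulfI p0); rewrite [RHS]mulrCA -eq -e !polyCM; ring.
Qed.

(** Each prime of c divides g or h; dividing it out there leaves the degrees unchanged. A
    factorization over the fraction field thus descends to the base. *)
Lemma descend_factorization c f g h : c != 0 -> f != 0 -> c%:P * f = g * h ->
  exists g' h', [/\ f = g' * h', size g' = size g & size h' = size h].
Proof.
move=> /facA[u [s [uu sP ->]]] f0; elim: s sP g h => [_|p s IHs sP] g h.
  rewrite big_nil mulr1 => e; exists (u^-1%:P * g), h; split => //.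
    by rewrite -mulrA -e mulrA -polyCM mulVr // mul1r.
  by rewrite mul_polyC size_scale // unit_neq0 ?unitrV.
rewrite big_cons => e; have pP : prime_elt p by apply: sP; rewrite mem_head.
have [p0 _ pd] := prime_polyC pP.
have sP' r : r \in s -> prime_elt r by move=> rs; apply: sP; rewrite inE rs orbT.
have sz r : size (p%:P * r) = size r by rewrite mul_polyC size_scale // -polyC_eq0.
have /pd[[g1 eg]|[h1 eh]] : rdvd p%:P (g * h).
- by rewrite -e; exists ((u * \prod_(r <- s) r)%:P * f); rewrite !polyCM; ring.
- rewrite eg sz; apply: IHs => //.
  by apply: (mulfI p0); rewrite [RHS]mulrA -eg -e !polyCM; ring.
- rewrite eh sz; apply: IHs => //.
  by apply: (mulfI p0); rewrite [RHS]mulrCA -eh -e !polyCM; ring.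
Qed.

Import Pdiv.Idomain.

(* Over a domain dvdp ignores nonzero constant factors: it is divisibility over the
   fraction field, and primitivity turns it back into divisibility. *)
Lemma indecomposable_prime f : primitive f -> (1 < size f)%N ->
  (forall g h, f = g * h -> (size g <= 1)%N \/ (size h <= 1)%N) -> prime_elt f.
Proof.
move=> prim ltf ind; have f0 : f != 0 by rewrite -size_poly_gt0; lia.
split => //; first by rewrite poly_unitE; case: eqP ltf => // ->.
move=> g h [q e]; pose d := gcdp f g.
have pdvd r : dvdp f r -> rdvd f r.
  move=> /dvdpP[[c k] /= c0 e']; apply: (primitive_cancel c0 prim (q := k)).
  by rewrite mul_polyC e' mulrC.
have d0 : d != 0 by rewrite gcdp_eq0 negb_and f0.
have df : dvdp d f by apply: dvdp_gcdl.
have led := dvdp_leq f0 df; have pd : (0 < size d)%N by rewrite size_poly_gt0.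
(* A gcd of size 1 gives f | h and one of full size gives f | g; any size in between would, once
   denominators are cleared, decompose f. *)
have [sd1|sdn1] := eqVneq (size d) 1%N.
  right; apply: pdvd; have cfg : coprimep f g by rewrite coprimep_def sd1.
  by rewrite -(Gauss_dvdpr _ cfg) e dvdp_mulr.
have [sdf|sdnf] := eqVneq (size d) (size f).
  left; apply: pdvd; have : d %= f by rewrite -(dvdp_size_eqp df) sdf.
  by move=> /eqp_dvdl <-; apply: dvdp_gcdr.
have /dvdpP[[c k] /= c0 ek] := df.
rewrite -mul_polyC in ek.
have [k' [d' [ef szk szd]]] := descend_factorization c0 f0 ek.
have k0 : k != 0.
  by apply: contraNneq f0 => k0; move/eqP: ek; rewrite k0 mul0r mulf_eq0 polyC_eq0 (negPf c0).
have szf : size f = (size k + size d).-1 by rewrite -size_mul // -ek mul_polyC size_scale.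
have := ind _ _ ef; rewrite szk szd; lia.
Qed.

Lemma factorial_primitive f : f != 0 -> primitive f ->
  exists (u : {poly A}) s, factorization f u s.
Proof.
have [N] := ubnP (size f); elim: N f => // N IHN f ltfN f0 prim.
have szf : (0 < size f)%N by rewrite size_poly_gt0.
(* A primitive constant is a unit: a prime factor of it would divide f. *)
have [sf1|sfn1] := eqVneq (size f) 1%N.
  have ef : f = (f`_0)%:P by apply: size1_polyC; rewrite sf1.
  have c0 : f`_0 != 0 by rewrite -polyC_eq0 -ef.
  have [u [s [uu sP e]]] := facA c0; exists f, [::]; rewrite /factorization big_nil mulr1; split => //.
  rewrite poly_unitE sf1 eqxx e; case: s sP e => [|p s] sP e; first by rewrite big_nil mulr1.
  case: (prim p); first by apply: sP; rewrite mem_head.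
  rewrite ef e big_cons; exists (u * \prod_(q <- s) q)%:P.
  by rewrite -polyCM mulrCA.
have [|nd] := pselect (exists g h, [/\ f = g * h, (1 < size g)%N & (1 < size h)%N]).
  move=> [g [h [ef lg lh]]].
  have [g0 h0] : g != 0 /\ h != 0 by rewrite -!size_poly_gt0; lia.
  have := size_mul g0 h0; rewrite -ef => szfgh.
  have [|//||u [s fg]] := IHN g; first lia.
    by move=> p pP pg; apply: (prim p pP); rewrite ef; apply: rdvdMr.
  have [|//||v [t ft]] := IHN h; first lia.
    by move=> p pP ph; apply: (prim p pP); rewrite ef; apply: rdvdMl.
  by exists (u * v), (s ++ t); rewrite ef; apply: factorizationM.
exists 1, [:: f]; rewrite /factorization big_seq1 mul1r unitr1; split => // p.
rewrite inE => /eqP ->; apply: indecomposable_prime => //; first lia.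
move=> g h e; case: (leqP (size g) 1) => lg; first by left.
case: (leqP (size h) 1) => lh; first by right.
by case: nd; exists g, h.
Qed.

Theorem factorial_poly : factorial {poly A}.
Proof.
move=> f f0; have [c [g [c0 gprim ef]]] := extract_content f0.
have g0 : g != 0 by apply: contraNneq f0 => g0; rewrite ef g0 mulr0.
have [v [t ft]] := factorial_primitive g0 gprim.
have [u [s [uu sP ec]]] := facA c0.
exists (u%:P * v), (map polyC s ++ t); rewrite ef; apply: factorizationM => //; split.
- by rewrite poly_unitE size_polyC coefC eqxx uu unit_neq0.
- by move=> _ /mapP[p /sP pP ->]; apply: prime_polyC.
- by rewrite big_map ec polyCM rmorph_prod.
Qed.

End Factorial.

Lemma factorial_iso (A B : idomainType) (f : {rmorphism A -> B}) (g : {rmorphism B -> A}) :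
  cancel f g -> cancel g f -> factorial A -> factorial B.
Proof.
move=> fK gK facA b b0; have gb0 : g b != 0 by rewrite -(rmorph0 g) (can_eq gK).
have [u [s [uu sP e]]] := facA _ gb0; exists (f u), (map f s); split.
- exact: rmorph_unit.
- move=> _ /mapP[p /sP[p0 pu pP] ->]; split.
  + by rewrite -(rmorph0 f) (can_eq fK).
  + by apply: contra pu => /(rmorph_unit g); rewrite fK.
  + move=> x y [c e']; have /pP[[d ed]|[d ed]] : rdvd p (g x * g y).
    * by exists (g c); rewrite -rmorphM e' rmorphM fK.
    * by left; exists (f d); rewrite -rmorphM -ed gK.
    * by right; exists (f d); rewrite -rmorphM -ed gK.
- by rewrite big_map -rmorph_prod -rmorphM -e gK.
Qed.

Lemma mpoly_rmorph_ext (n : nat) (R : comNzRingType) (B : nzRingType)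
    (f g : {rmorphism {mpoly R[n]} -> B}) :
  (forall c, f c%:MP = g c%:MP) -> (forall i, f 'X_i = g 'X_i) -> f =1 g.
Proof.
move=> eC eX p; rewrite [p]mpolyE !rmorph_sum; apply: eq_bigr => m _ /=.
rewrite -mul_mpolyC !rmorphM eC /= mpolyXE_id !rmorph_prod /=; congr (_ * _).
by apply: eq_bigr => i _; rewrite !rmorphXn /= eX.
Qed.

Section MpolyFactorial.
Variables (K : fieldType).

Lemma factorial_mpoly0 : factorial {mpoly K[0]}.
Proof.
move=> p p0; exists p, [::]; split => //; last by rewrite big_nil mulr1.
have ep : p = (p@_0%MM)%:MP.
  apply/mpolyP => m; rewrite mcoeffC; have -> : m = 0%MM by apply/mnmP; case.
  by rewrite eqxx mulr1.
have c0 : p@_0%MM != 0 by apply: contraNneq p0 => c0; rewrite ep c0 mpolyC0.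
by apply/unitrPr; exists (p@_0%MM)^-1%:MP; rewrite {1}ep -mpolyCM mulfV.
Qed.

Variable n : nat.

(** The inverse of [muni]; it carries factoriality from n to n + 1 variables. *)
Definition of_uni : {poly {mpoly K[n]}} -> {mpoly K[n.+1]} :=
  horner_eval 'X_ord_max \o map_poly (@mwiden n K).

HB.instance Definition _ := GRing.RMorphism.on of_uni.

Lemma muniX_max : muni ('X_ord_max : {mpoly K[n.+1]}) = 'X.
Proof.
rewrite muniE msuppX big_seq1 mcoeffX eqxx scale1r mnm1E eqxx expr1.
suff -> : [multinom U_(ord_max)%MM (widen_ord (leqnSn n) i) | i < n] = 0%MM.
  by rewrite mpolyX0 scale1r.
by apply/mnmP => i; rewrite mnmE mnm0E mnm1E -val_eqE /= gtn_eqF.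
Qed.

Lemma muniX_widen (i : 'I_n) :
  muni ('X_(widen_ord (leqnSn n) i) : {mpoly K[n.+1]}) = ('X_i)%:P.
Proof.
rewrite muniE msuppX big_seq1 mcoeffX eqxx scale1r mnm1E -val_eqE /= ltn_eqF // expr0.
rewrite -mul_polyC mulr1; congr (_ %:P); congr 'X_[_]; apply/mnmP => j.
by rewrite mnmE !mnm1E -!val_eqE.
Qed.

Lemma of_uniC (p : {mpoly K[n]}) : of_uni p%:P = mwiden p.
Proof. by rewrite /of_uni /= map_polyC /horner_eval hornerC. Qed.

Lemma of_uniX : of_uni 'X = 'X_ord_max.
Proof. by rewrite /of_uni /= map_polyX /horner_eval hornerX. Qed.

Lemma mwidenX1 (i : 'I_n) : mwiden ('X_i : {mpoly K[n]}) = 'X_(widen_ord (leqnSn n) i).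
Proof. by rewrite mwidenX mnmwiden1. Qed.

Lemma muniK : cancel (@muni n K) of_uni.
Proof.
apply: (mpoly_rmorph_ext (f := of_uni \o @muni n K) (g := idfun)) => [c|i] /=.
  by rewrite muniC of_uniC mwidenC.
case: (unliftP ord_max i) => [j|] ->; last by rewrite muniX_max of_uniX.
have -> : lift ord_max j = widen_ord (leqnSn n) j by apply: val_inj; rewrite /= /bump leqNgt ltn_ord.
by rewrite muniX_widen of_uniC mwidenX1.
Qed.

Lemma of_uniK : cancel of_uni (@muni n K).
Proof.
have wK : @muni n K \o @mwiden n K =1 polyC.
  apply: mpoly_rmorph_ext => [c|i] /=; first by rewrite mwidenC muniC.
  by rewrite mwidenX1 muniX_widen.
move=> p; rewrite -[p]coefK poly_def !rmorph_sum; apply: eq_bigr => i _ /=.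
rewrite -mul_polyC !rmorphM !rmorphXn /= of_uniX muniX_max of_uniC.
by rewrite -[muni (mwiden _)]/((@muni n K \o @mwiden n K) _) wK.
Qed.

End MpolyFactorial.

Lemma factorial_mpoly (K : fieldType) (n : nat) : factorial {mpoly K[n]}.
Proof.
elim: n => [|n IHn]; first exact: factorial_mpoly0.
have facp := factorial_poly IHn.
pose A := {poly {mpoly K[n]}} : idomainType.
pose B := {mpoly K[n.+1]} : idomainType.
pose f : {rmorphism A -> B} := @of_uni K n.
pose g : {rmorphism B -> A} := @muni n K.
have fK : cancel f g := @of_uniK K n.
have gK : cancel g f := @muniK K n.
exact: (factorial_iso fK gK facp).
Qed.

(** * Class groups of Krull domains *)

Section FactorialSubring.
Variables (F : fieldType) (T : F -> Prop).

Definition unit_in (t : F) := [/\ t != 0, T t & T t^-1].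

(** Divisibility in the subring [T] is membership of the quotient in [T]. Units are allowed, so that
    a prime which becomes invertible under localization may stay in a factorization. *)
Definition prime_in (p : F) :=
  [/\ p != 0, T p & forall a b, T a -> T b -> T (a * b / p) -> T (a / p) \/ T (b / p)].

Definition factorial_in := forall x, T x -> x != 0 ->
  exists u s, [/\ unit_in u, forall p, p \in s -> prime_in p & x = u * \prod_(p <- s) p].

Hypothesis T1 : T 1.
Hypothesis TM : forall x y, T x -> T y -> T (x * y).
Hypothesis T_factorial : factorial_in.

(** For each p in s some y in N is not divisible by p; as p divides c y, it divides c and can be
    cancelled. *)
Lemma div_by_primes (N : F -> Prop) s :
  (forall p, p \in s -> prime_in p) -> (forall y, N y -> T y) ->
  (forall p, p \in s -> ~ forall y, N y -> T (y / p)) ->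
  forall c, T c -> (forall y, N y -> T (c * y / \prod_(p <- s) p)) ->
  T (c / \prod_(p <- s) p).
Proof.
move=> sP NT; elim: s sP => [_ _ c Tc _|p s IHs sP nd c Tc cN].
  by rewrite big_nil divr1.
have [p0 Tp pP] : prime_in p by apply: sP; rewrite mem_head.
have sP' z : z \in s -> prime_in z by move=> zs; apply: sP; rewrite inE zs orbT.
have Ts : T (\prod_(z <- s) z).
  by rewrite big_seq; elim/big_ind: _ => // z /sP'[].
have s0 : \prod_(z <- s) z != 0.
  by rewrite prodf_seq_neq0; apply/allP => z /sP'[].
have Tcp : T (c / p).
  have /existsNP[y /not_implyP[Ny ny]] := nd p (mem_head p s).
  case: (pP c y Tc (NT _ Ny)) => //.
  have := TM (cN _ Ny) Ts; rewrite big_cons invfM mulrA mulfVK //.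
rewrite big_cons invfM mulrA; apply: IHs => //.
  by move=> z zs; apply: nd; rewrite inE zs orbT.
move=> y /cN; rewrite big_cons invfM; congr T; field.
by rewrite p0 s0.
Qed.

(* In other words (T : N) is principal. *)
Lemma principal_dual (N : F -> Prop) : (forall y, N y -> T y) -> (exists2 x, N x & x != 0) ->
  exists2 g, g != 0 & forall x, (forall y, N y -> T (x * y)) <-> T (x * g).
Proof.
move=> NT [n0 Nn0 n00]; have [u [s [uu sP e]]] := T_factorial (NT _ Nn0) n00.
have [k] := ubnP (size s); elim: k N n0 u s NT Nn0 n00 uu sP e => // k IHk N n0 u s.
move=> NT Nn0 n00 [u0 Tu Tui] sP e ltsk.
(* A prime of [n0] dividing all of N is divided out, which shortens the factorization of [n0]. *)
have [|nd] := pselect (exists2 p, p \in s & forall y, N y -> T (y / p)).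
  move=> [p ps Np]; have [p0 Tp _] := sP p ps.
  have sP' z : z \in rem p s -> prime_in z by move=> /mem_rem/sP.
  have en0 : n0 / p = u * \prod_(z <- rem p s) z.
    by rewrite e (big_rem p ps) /= mulrCA mulrC mulKf.
  have [|||||//||g g0 gP] := IHk (fun z => N (z * p)) (n0 / p) u (rem p s).
  - by move=> z /= /Np; rewrite mulfK.
  - by rewrite /= mulfVK.
  - by rewrite mulf_neq0 ?invr_neq0.
  - by split.
  - exact: sP'.
  - by rewrite size_rem //; move: ps ltsk; case: s {sP e sP' en0}.
  exists (p * g); first by rewrite mulf_neq0.
  move=> x; rewrite mulrA; apply: (iff_trans _ (gP _)); split=> xN y Ny.
    by rewrite -mulrA [p * _]mulrC; apply: xN.
  by have := xN (y / p); rewrite /= mulfVK // -mulrA [p * _]mulrC mulfVK //; apply.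
(* No prime of [n0] divides all of N, so (T : N) is T: put c = x n0 / u; then c y / \prod s = x y
   lies in T for y in N, whence x = c / \prod s does too. *)
exists 1; rewrite ?oner_neq0 // => x; rewrite mulr1; split=> [xN|Tx y /NT]; last exact: TM.
have s0 : \prod_(z <- s) z != 0 by apply: contraNneq n00 => s0; rewrite e s0 mulr0.
have -> : x = (x * n0 / u) / \prod_(z <- s) z by rewrite e; field; rewrite u0 s0.
apply: (div_by_primes (N := N)) => //.
- by move=> p ps pN; apply: nd; exists p.
- by apply: TM => //; apply: xN.
- move=> y Ny; have := TM (xN _ Ny) (T1); congr T; rewrite e; field.
  by rewrite u0 s0.
Qed.

End FactorialSubring.

Lemma divf_translate (F : fieldType) (g h t : F) :
  g != 0 -> h != 0 -> t != 0 -> g / (h * (g * t / h)) = t^-1.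
Proof. by move=> g0 h0 t0; field; rewrite g0 h0 t0. Qed.

(** * The class group of a ring cut out of a factorial ring by valuations *)

Section KrullClassGroup.
Variable R : idomainType.
Local Notation F := {fraction R}.
Local Open Scope classical_set_scope.

Variables (T : F -> Prop) (J : Type) (v : J -> F -> int).
Variables (r : nat) (q : (J -> int) -> 'rV[int]_r).

Hypothesis T1 : T 1.
Hypothesis TM : forall x y, T x -> T y -> T (x * y).
Hypothesis TD : forall x y, T x -> T y -> T (x + y).
Hypothesis T_factorial : factorial_in T.
Hypothesis vM : forall j (x y : F), x != 0 -> y != 0 -> v j (x * y) = v j x + v j y.
Hypothesis vD : forall j (k : int) (x y : F), x != 0 -> y != 0 -> x + y != 0 ->
  k <= v j x -> k <= v j y -> k <= v j (x + y).
Hypothesis in_baseP : forall x, in_base x <-> T x /\ forall j, x != 0 -> 0 <= v j x.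
(** Units of [T] provide elements of an ideal with all values large enough; exactness at one index
    makes the prescribed bound there an attained minimum. *)
Hypothesis unit_above : forall d : J -> int, exists2 t : F, unit_in T t & forall j, d j <= v j t.
Hypothesis unit_exact : forall (d : J -> int) j0,
  exists2 t : F, unit_in T t & (forall j, d j <= v j t) /\ v j0 t = d j0.
(** [q] presents Z^r as the quotient of the value vectors by those of the units of [T]. *)
Hypothesis qD : forall a b : J -> int, q (fun j => a j + b j) = q a + q b.
Hypothesis q_surj : forall z, exists d, q d = z.
Hypothesis q_unit : forall t : F, unit_in T t -> q (v^~ t) = 0.
Hypothesis q_ker : forall d : J -> int, q d = 0 -> exists2 t : F, unit_in T t & forall j, v j t = d j.

Let base_T x : in_base x -> T x. Proof. by case/in_baseP. Qed.

Let T0 : T 0. Proof. exact/base_T/in_base0. Qed.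

Let v1 j : v j 1 = 0.
Proof.
have := vM j (oner_neq0 F) (oner_neq0 F); rewrite mulr1 => /eqP.
by rewrite -subr_eq0 opprD addrA subrr add0r oppr_eq0 => /eqP.
Qed.

Let vV j x : x != 0 -> v j x^-1 = - v j x.
Proof.
move=> x0; apply/eqP; rewrite -addr_eq0 addrC -vM ?invr_neq0 //.
by rewrite mulfV // v1.
Qed.

(* In the language of Weil divisors, g records the part of the divisor that meets
   Spec T, where T is factorial, and m the multiplicities along the remaining primes. *)
Definition krull_ideal (g : F) (m : J -> int) : set F :=
  [set x | T (x / g) /\ forall j, x != 0 -> m j <= v j x].

(** These are the data of I that its dual sees: (T : I) = g^-1 T, and m_j is the minimum of v_j
    attained on I. *)
Definition ideal_type (I : set F) (g : F) (m : J -> int) :=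
  [/\ g != 0, forall x, (forall y, I y -> T (x * y)) <-> T (x * g),
    forall j y, I y -> y != 0 -> m j <= v j y
  & forall j, exists y, [/\ I y, y != 0 & v j y = m j]].

(** The denominator d puts d I inside T, where the dual is principal, and bounds v_j below on I by -
    v_j(d), so that an integer minimum is attained. *)
Lemma ideal_typeP I : fractional_ideal I -> exists g m, ideal_type I g m.
Proof.
move=> [_ [x Ix x0] [d d0 Id]].
have td0 : FracField.tofrac d != 0 by rewrite tofrac_eq0.
have [||g g0 gP] := @principal_dual _ T T1 TM T_factorial [set z | I (z / FracField.tofrac d)].
- by move=> z /Id /base_T; rewrite mulrCA mulfV // mulr1.
- exists (x * FracField.tofrac d); first by rewrite /= mulfK.
  by rewrite mulf_neq0.
have mP j : exists m : int,
    (forall y, I y -> y != 0 -> m <= v j y) /\ exists y, [/\ I y, y != 0 & v j y = m].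
  have ge0 y : I y -> y != 0 -> 0 <= v j y + v j (FracField.tofrac d).
    by move=> /Id/in_baseP[_ /(_ j)] + y0; rewrite mulf_neq0 // vM // addrC; apply.
  have ex : exists k, `[< exists y, [/\ I y, y != 0 & v j y + v j (FracField.tofrac d) = k%:Z] >].
    exists (absz (v j x + v j (FracField.tofrac d))); apply/asboolP; exists x; split => //.
    by rewrite gez0_abs // ge0.
  case: (ex_minnP ex) => k /asboolP[y [Iy y0 ey]] mink.
  exists (k%:Z - v j (FracField.tofrac d)); split=> [z Iz z0|]; last first.
    by exists y; rewrite -ey addrK.
  have := ge0 z Iz z0; rewrite lerBlDr; case e: (_ + _) => [l|//] _.
  by rewrite lez_nat; apply: mink; apply/asboolP; exists z.
have {mP}[m mP] := choice mP.
exists (g / FracField.tofrac d), m; split; last by move=> j; case: (mP j).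
- by rewrite mulf_neq0 ?invr_neq0.
- move=> z; rewrite mulrA mulrAC; apply: (iff_trans _ (gP _)); split=> zI y /=.
    by move=> /zI; rewrite mulrA mulrAC.
  by move=> Iy; have := zI (y * FracField.tofrac d); rewrite /= mulfK // mulrACA mulVf // mulr1; apply.
- by move=> j; case: (mP j).
Qed.

Lemma ideal_type_dual I g m : ideal_type I g m ->
  dual I = krull_ideal g^-1 (fun j => - m j).
Proof.
move=> [g0 gP mle mex]; apply/seteqP; split=> x.
  move=> dx; split.
    by rewrite invrK; apply/gP => y /dx /base_T.
  move=> j x0; have [y [Iy y0 ey]] := mex j.
  have /in_baseP[_ /(_ j)] := dx _ Iy.
  by rewrite mulf_neq0 // vM // ey => /(_ isT); lia.
move=> [Tx mx] y Iy; apply/in_baseP; split.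
  by move: y Iy; apply/gP; rewrite invrK in Tx.
move=> j; rewrite mulf_eq0 negb_or => /andP[x0 y0]; rewrite vM //.
by have := mx j x0; have := mle j y Iy y0; lia.
Qed.

(** The elements g t with t a unit of [T] witness everything: t above m - v(g) gives an element of
    the ideal generating g T, and exactness at j gives one of value m_j. *)
Lemma krull_ideal_type g m : g != 0 -> ideal_type (krull_ideal g m) g m.
Proof.
move=> g0; split => //.
- move=> x; split=> [xD|Tx y [Ty _]]; last first.
    by have := TM Tx Ty; rewrite -mulrA [g * _]mulrC mulfVK.
  have [t [t0 Tt Tti] td] := unit_above (fun j => m j - v j g).
  have Dgt : krull_ideal g m (g * t).
    split=> [|j _]; first by rewrite mulrC mulKf.
    by rewrite vM // -lerBlDl.
  by have := TM (xD _ Dgt) Tti; rewrite mulrA mulfK.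
- by move=> j y [_ my] y0; apply: my.
- move=> j; have [t [t0 Tt Tti] [td tj]] := unit_exact (fun j => m j - v j g) j.
  exists (g * t); split.
  + split=> [|k _]; first by rewrite mulrC mulKf.
    by rewrite vM // -lerBlDl.
  + by rewrite mulf_neq0.
  + by rewrite vM // tj addrC subrK.
Qed.

Lemma krull_ideal_dual g m : g != 0 ->
  dual (krull_ideal g m) = krull_ideal g^-1 (fun j => - m j).
Proof. by move=> g0; apply: ideal_type_dual (krull_ideal_type _ g0). Qed.

Lemma krull_ideal_fractional g m : g != 0 -> fractional_ideal (krull_ideal g m).
Proof.
move=> g0; split.
- split=> [|x y [Tx mx] [Ty my]|s x [Tx mx]].
  + by split=> [|j]; rewrite ?mul0r ?eqxx //; apply: T0.
  + split=> [|j xy0]; first by rewrite mulrDl; apply: TD.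
    have [x0|x0] := eqVneq x 0; first by move: xy0; rewrite x0 add0r; apply: my.
    have [y0|y0] := eqVneq y 0; first by move: xy0; rewrite y0 addr0; apply: mx.
    by apply: vD => //; [apply: mx|apply: my].
  + have bs : in_base (FracField.tofrac s) by exists s.
    split=> [|j]; first by rewrite -mulrA; apply: TM => //; apply: base_T.
    rewrite mulf_eq0 negb_or => /andP[s0 x0]; rewrite vM //.
    have /in_baseP[_ /(_ j s0)] := bs; have := mx j x0; lia.
- have [t [t0 Tt Tti] td] := unit_above (fun j => m j - v j g).
  exists (g * t); last by rewrite mulf_neq0.
  split=> [|j _]; first by rewrite mulrC mulKf.
  by rewrite vM // -lerBlDl.
(* A nonzero element of the dual multiplies the ideal into R; cleared of its own denominator, it is
   a common denominator lying in R. *)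
- have gV0 : g^-1 != 0 by rewrite invr_neq0.
  have [t [t0 Tt Tti] td] := unit_above (fun j => - m j - v j g^-1).
  have dz : dual (krull_ideal g m) (g^-1 * t).
    rewrite krull_ideal_dual //; split=> [|j _]; first by rewrite mulrC mulKf.
    by rewrite vM // -lerBlDl.
  have [d d0 [s es]] := fraction_denom (g^-1 * t).
  exists s; last by move=> x /dz bx; rewrite -es -mulrA; apply: in_baseM => //; exists d.
  by rewrite -tofrac_eq0 -es !mulf_neq0 // tofrac_eq0.
Qed.

Lemma krull_ideal_divisorial g m : g != 0 -> divisorial (krull_ideal g m).
Proof.
move=> g0; split; first exact: krull_ideal_fractional.
rewrite !krull_ideal_dual ?invr_neq0 // invrK.
by congr krull_ideal; apply: funext => j; rewrite opprK.
Qed.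

Definition krull_divisor g m (g0 : g != 0) : divisor R :=
  Divisor (krull_ideal_divisorial m g0).

Lemma krull_divisorP (I : divisor R) : exists g m (g0 : g != 0), I = krull_divisor m g0.
Proof.
have [fI dI] := divisorP I; have [g [m Igm]] := ideal_typeP fI.
have [g0 _ _ _] := Igm; exists g, m, g0; apply: divisor_inj.
rewrite -dI (ideal_type_dual Igm) krull_ideal_dual ?invr_neq0 //= invrK.
by congr krull_ideal; apply: funext => j; rewrite opprK.
Qed.

(** Duals suffice for the comparison: the condition over T is passed through the two principal duals
    in turn, and attained minima add under multiplication. *)
Lemma krull_divisorD g h m n (g0 : g != 0) (h0 : h != 0) :
  krull_divisor m g0 + krull_divisor n h0 =
  krull_divisor (fun j => m j + n j) (mulf_neq0 g0 h0).
Proof.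
apply: divisor_inj => /=.
suff -> : dual (ideal_mul (krull_ideal g m) (krull_ideal h n)) =
    dual (krull_ideal (g * h) (fun j => m j + n j)).
  by case: (krull_ideal_divisorial (fun j => m j + n j) (mulf_neq0 g0 h0)).
rewrite krull_ideal_dual ?mulf_neq0 //.
have [_ gP mle mex] := krull_ideal_type m g0.
have [_ hP nle nex] := krull_ideal_type n h0.
apply/seteqP; split=> x.
  move=> /dual_mulP dx; split.
    rewrite invrK mulrA; apply/hP => b Db.
    rewrite mulrAC; apply/gP => a Da; rewrite -mulrA [b * a]mulrC.
    exact/base_T/dx.
  move=> j x0; have [a [Da a0 ea]] := mex j; have [b [Db b0 eb]] := nex j.
  have /in_baseP[_ /(_ j)] := dx _ _ Da Db.
  rewrite !mulf_neq0 // !vM ?mulf_neq0 // ea eb => /(_ isT); lia.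
move=> [Tx mx]; apply/dual_mulP => a b Da Db; apply/in_baseP; split.
  rewrite mulrA; move: b Db; apply/hP.
  rewrite mulrAC; move: a Da; apply/gP.
  by move: Tx; rewrite invrK mulrA mulrAC.
move=> j; rewrite !mulf_eq0 !negb_or => /andP[x0 /andP[a0 b0]].
rewrite !vM ?mulf_neq0 //.
have := mx j x0; have := mle j a Da a0; have := nle j b Db b0; lia.
Qed.

Lemma principal_krull a (a0 : a != 0) : principal_divisor a0 = krull_divisor (v^~ a) a0.
Proof.
apply: divisor_inj => /=; apply/seteqP; split=> x.
  move=> [s ->]; have bs : in_base (FracField.tofrac s) by exists s.
  split=> [|j]; first by rewrite mulfK //; apply: base_T.
  rewrite mulf_eq0 negb_or => /andP[s0 _]; rewrite vM //.
  have /in_baseP[_ /(_ j s0)] := bs; lia.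
move=> [Tx vx]; have /in_baseP[s es] : T (x / a) /\ forall j, x / a != 0 -> 0 <= v j (x / a).
  split=> // j; rewrite mulf_eq0 negb_or => /andP[x0 aV0].
  by rewrite vM // vV // subr_ge0; apply: vx.
by exists s; rewrite -es mulfVK.
Qed.

Lemma krull_divisor_inj g h m n (g0 : g != 0) (h0 : h != 0) :
  krull_divisor m g0 = krull_divisor n h0 -> unit_in T (g / h) /\ m = n.
Proof.
move=> /(congr1 (fun I : divisor R => I : set F)) /= e.
have [_ gP mle mex] := krull_ideal_type m g0.
have [_ hP nle nex] := krull_ideal_type n h0.
rewrite e in gP mle mex; split; last first.
  apply: funext => j; apply: le_anti.
  have [y [Dy y0 ey]] := nex j; have [z [Dz z0 ez]] := mex j.
  by rewrite -{1}ey mle //= -ez nle.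
have Tgh (x : F) : T (x * g) <-> T (x * h) by split=> [/gP/hP|/hP/gP].
split; first by rewrite mulf_neq0 ?invr_neq0.
  by rewrite mulrC; apply/(Tgh h^-1); rewrite mulVf.
by rewrite invfM invrK; apply/(Tgh g^-1); rewrite mulVf.
Qed.

Lemma krull_divisor_unit g h m (g0 : g != 0) (h0 : h != 0) :
  unit_in T (g / h) -> krull_divisor m g0 = krull_divisor m h0.
Proof.
move=> [_ Tgh Thg]; apply: divisor_inj; apply/seteqP; split=> x [Tx mx]; split=> //.
  by have := TM Tx Tgh; rewrite mulrA mulfVK.
by have := TM Tx Thg; rewrite invfM invrK mulrCA mulrC mulfVK // mulrC.
Qed.

Let q0 : q (fun=> 0) = 0.
Proof.
have := qD (fun=> 0) (fun=> 0); rewrite (_ : (fun j => 0 + 0) = fun=> 0).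
  by move=> /eqP; rewrite -subr_eq0 opprD addrA subrr add0r oppr_eq0 => /eqP.
by apply: funext => j; rewrite addr0.
Qed.

Let qB a b : q (fun j => a j - b j) = q a - q b.
Proof.
apply/eqP; rewrite -subr_eq addrC eq_sym; apply/eqP.
rewrite opprK -qD; congr q; apply: funext => j; lia.
Qed.

(** Two presentations share m, and their generators differ by a unit of [T], whose values [q]
    kills. *)
Lemma divisor_degree_exists (I : divisor R) : exists z,
  forall g m (g0 : g != 0), I = krull_divisor m g0 -> z = q (fun j => m j - v j g).
Proof.
have [g [m [g0 ->]]] := krull_divisorP I.
exists (q (fun j => m j - v j g)) => h n h0 /krull_divisor_inj[ugh <-].
have vgh j : v j (g / h) = v j g - v j h by rewrite vM ?invr_neq0 // vV.
rewrite !qB; congr (_ - _); apply/eqP; rewrite -subr_eq0 -qB.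
by rewrite -(q_unit ugh); apply/eqP; congr q; apply: funext => j; rewrite vgh.
Qed.

Definition divisor_degree (I : divisor R) : 'rV[int]_r := sval (cid (divisor_degree_exists I)).

Lemma divisor_degreeE g m (g0 : g != 0) :
  divisor_degree (krull_divisor m g0) = q (fun j => m j - v j g).
Proof. by rewrite /divisor_degree; case: cid => z /= /(_ _ _ _ erefl). Qed.

Lemma divisor_degreeD I I' :
  divisor_degree (I + I') = divisor_degree I + divisor_degree I'.
Proof.
have [g [m [g0 ->]]] := krull_divisorP I; have [h [n [h0 ->]]] := krull_divisorP I'.
rewrite krull_divisorD !divisor_degreeE -qD; congr q; apply: funext => j.
rewrite vM //; lia.
Qed.

Lemma divisor_degree_lin_equiv I I' :
  lin_equiv I I' <-> divisor_degree I = divisor_degree I'.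
Proof.
split=> [/asboolP[a [a0 ->]]|].
  rewrite divisor_degreeD principal_krull divisor_degreeE.
  rewrite [X in _ + X](_ : _ = 0) ?addr0 // -q0; congr q.
  by apply: funext => j; rewrite subrr.
have [g [m [g0 ->]]] := krull_divisorP I; have [h [n [h0 ->]]] := krull_divisorP I'.
rewrite !divisor_degreeE => /eqP; rewrite -subr_eq0 -qB => /eqP/q_ker[t ut vt].
have [t0 Tt Tti] := ut; have hV0 : h^-1 != 0 by rewrite invr_neq0.
(* Here v(t) = (m - v(g)) - (n - v(h)). Multiplying the second ideal by g t / h turns n into m and h
   into g t, which agrees with g up to a unit. *)
have a0 : g * t / h != 0 by rewrite !mulf_neq0.
apply/asboolP; exists (g * t / h), a0; rewrite principal_krull krull_divisorD.
rewrite (_ : (fun j => _) = m); last first.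
  by apply: funext => j; rewrite !vM ?mulf_neq0 // vV // vt; lia.
apply: krull_divisor_unit.
have -> : g / (h * (g * t / h)) = t^-1.
  exact: divf_translate.
by split; rewrite ?invr_neq0 ?invrK.
Qed.

Lemma class_group_free : free_abelian_of_rank (class_group R) r.
Proof.
pose f (c : class_group R) := divisor_degree (repr c).
have f_pi I : f (\pi_(class_group R)%qT I) = divisor_degree I.
  by apply/divisor_degree_lin_equiv; rewrite -class_eqE reprK.
have f_add : nmod_morphism f.
  split=> [|x y]; last first.
    by rewrite -[x]reprK -[y]reprK -[_ + _]/(class_add _ _) -pi_class_add !f_pi divisor_degreeD.
  have := divisor_degreeD 0 0; rewrite addr0 => /eqP.
  rewrite -subr_eq0 opprD addrA subrr add0r oppr_eq0 => /eqP e0.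
  by rewrite -[0]/(class_zero R) f_pi.
pose fA := GRing.isNmodMorphism.Build (class_group R) 'rV[int]_r f f_add.
exists (HB.pack_for {additive class_group R -> 'rV[int]_r} f fA).
have f_inj : injective f.
  move=> x y /divisor_degree_lin_equiv; rewrite -class_eqE => /eqP.
  by rewrite !reprK.
have f_surj z : exists c, f c = z.
  have [d <-] := q_surj z; exists (\pi_(class_group R)%qT (krull_divisor d (oner_neq0 F))).
  rewrite f_pi divisor_degreeE; congr q; apply: funext => j.
  by rewrite v1 subr0.
have [g gK] := choice f_surj; exists g => // x.
by apply: f_inj; rewrite gK.
Qed.

End KrullClassGroup.

(** * Monomial valuations of the toric ring *)

Section PolyOrder.
Variable D : idomainType.
Implicit Types p : {poly D}.

(** The order of vanishing at 0, with value 0 on the zero polynomial. *)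
Definition poly_ord p : nat := find (fun c => c != 0) p.

Lemma poly_ord_neq0 p : p != 0 -> p`_(poly_ord p) != 0.
Proof.
move=> p0; rewrite /poly_ord; apply: (@nth_find _ 0 (fun c => c != 0)); apply/hasP; exists (lead_coef p).
  by rewrite lead_coefE mem_nth // prednK // size_poly_gt0.
by rewrite lead_coef_eq0.
Qed.

Lemma poly_ord_before p i : (i < poly_ord p)%N -> p`_i = 0.
Proof. by move=> lti; have /negbFE/eqP := before_find 0 lti. Qed.

Lemma poly_ord_ge p k : p != 0 -> (k <= poly_ord p)%N <-> forall i, (i < k)%N -> p`_i = 0.
Proof.
move=> p0; split=> [lek i ltik|kP]; first by apply: poly_ord_before; apply: leq_trans lek.
by rewrite leqNgt; apply/negP => /kP/eqP; rewrite (negPf (poly_ord_neq0 p0)).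
Qed.

Lemma poly_ord_eq p k : p`_k != 0 -> (forall i, (i < k)%N -> p`_i = 0) -> poly_ord p = k.
Proof.
move=> pk kP; have p0 : p != 0 by apply: contraNneq pk => ->; rewrite coef0.
apply/eqP; rewrite eqn_leq (introT idP ((poly_ord_ge k p0).2 kP)) andbT.
by rewrite leqNgt; apply/negP => /poly_ord_before/eqP; rewrite (negPf pk).
Qed.

Lemma poly_ordM p1 p2 : p1 != 0 -> p2 != 0 ->
  poly_ord (p1 * p2) = (poly_ord p1 + poly_ord p2)%N.
Proof.
move=> p10 p20; apply: poly_ord_eq => [|k ltk]; rewrite coefM.
  have lt : (poly_ord p1 < (poly_ord p1 + poly_ord p2).+1)%N by rewrite ltnS leq_addr.
  rewrite (bigD1 (Ordinal lt)) //= addKn big1 ?addr0 ?mulf_neq0 ?poly_ord_neq0 //.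
  move=> j; rewrite -val_eqE /= neq_ltn => /orP[ltj|ltj].
    by rewrite poly_ord_before ?mul0r.
  by rewrite mulrC poly_ord_before ?mul0r //; have := ltn_ord j; lia.
rewrite big1 // => j _; case: (ltnP j (poly_ord p1)) => ltj.
  by rewrite poly_ord_before ?mul0r.
by rewrite mulrC poly_ord_before ?mul0r //; have := ltn_ord j; lia.
Qed.

Lemma poly_ordD k p1 p2 : p1 != 0 -> p2 != 0 -> p1 + p2 != 0 ->
  (k <= poly_ord p1)%N -> (k <= poly_ord p2)%N -> (k <= poly_ord (p1 + p2))%N.
Proof.
move=> p10 p20 p120 /poly_ord_ge -/(_ p10) k1 /poly_ord_ge -/(_ p20) k2.
by apply/poly_ord_ge => // i lti; rewrite coefD k1 ?k2 ?addr0.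
Qed.

End PolyOrder.

Section FractionValuation.
Variables (R D : idomainType) (psi : R -> {poly D}).
Hypothesis psiD : {morph psi : x y / x + y}.
Hypothesis psiM : {morph psi : x y / x * y}.
Hypothesis psi_inj : forall x, psi x = 0 -> x = 0.
Local Notation F := {fraction R}.
Local Notation tofrac := (@FracField.tofrac R).

Lemma psi_neq0 x : x != 0 -> psi x != 0.
Proof. by apply: contraNneq => /psi_inj->. Qed.

Lemma fractionP (x : F) : exists a b, b != 0 /\ x = tofrac a / tofrac b.
Proof.
have [b b0 [a e]] := fraction_denom x; exists a, b; split => //.
by rewrite -e mulrC mulKf // tofrac_eq0.
Qed.

(** Orders add under products, so a d = c b makes the difference independent of the fraction. At x =
    0 the condition is vacuous and the chosen integer arbitrary. *)
Lemma frac_val_exists (x : F) : exists z : int, forall a b, a != 0 -> b != 0 ->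
  x = tofrac a / tofrac b -> z = (poly_ord (psi a))%:Z - (poly_ord (psi b))%:Z.
Proof.
have [a [b [b0 ->]]] := fractionP x.
exists ((poly_ord (psi a))%:Z - (poly_ord (psi b))%:Z) => c d c0 d0 /eqP.
rewrite eqr_div ?tofrac_eq0 // -!tofracM tofrac_eq => /eqP e.
have a0 : a != 0.
  by apply: contraTneq (mulf_neq0 c0 b0) => a0; rewrite -e a0 mul0r eqxx.
have := congr1 (fun z => poly_ord (psi z)) e; rewrite !psiM !poly_ordM ?psi_neq0 //; lia.
Qed.

Definition frac_val (x : F) : int := sval (cid (frac_val_exists x)).

Lemma frac_valE a b : a != 0 -> b != 0 ->
  frac_val (tofrac a / tofrac b) = (poly_ord (psi a))%:Z - (poly_ord (psi b))%:Z.
Proof. by move=> a0 b0; rewrite /frac_val; case: cid => z /= /(_ a b a0 b0 erefl). Qed.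

Lemma frac_valM (x y : F) : x != 0 -> y != 0 -> frac_val (x * y) = frac_val x + frac_val y.
Proof.
have [a [b [b0 ->]]] := fractionP x; have [c [d [d0 ->]]] := fractionP y.
rewrite !mulf_eq0 !invr_eq0 !tofrac_eq0 (negPf b0) (negPf d0) !orbF => a0 c0.
rewrite mulf_div -!tofracM !frac_valE ?mulf_neq0 // !psiM !poly_ordM ?psi_neq0 //; lia.
Qed.

Lemma frac_valD (k : int) (x y : F) : x != 0 -> y != 0 -> x + y != 0 ->
  k <= frac_val x -> k <= frac_val y -> k <= frac_val (x + y).
Proof.
have [a [b [b0 ->]]] := fractionP x; have [c [d [d0 ->]]] := fractionP y.
rewrite addf_div ?tofrac_eq0 // -!tofracM -tofracD.
rewrite !mulf_eq0 !invr_eq0 !tofrac_eq0 !mulf_eq0 (negPf b0) (negPf d0) !orbF => a0 c0 s0.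
rewrite !frac_valE ?mulf_neq0 // psiD !psiM => ka kc.
have [ad0 cb0] : psi a * psi d != 0 /\ psi c * psi b != 0 by rewrite !mulf_neq0 ?psi_neq0.
have s0' : psi a * psi d + psi c * psi b != 0 by rewrite -!psiM -psiD psi_neq0.
pose l := minn (poly_ord (psi a * psi d)) (poly_ord (psi c * psi b)).
have := poly_ordD ad0 cb0 s0' (geq_minl _ _ : (l <= _)%N) (geq_minr _ _ : (l <= _)%N).
rewrite /l !poly_ordM ?psi_neq0 //; lia.
Qed.

Lemma frac_val_tofrac a : a != 0 -> psi 1 = 1 -> frac_val (tofrac a) = (poly_ord (psi a))%:Z.
Proof.
move=> a0 psi1; have := frac_valE a0 (oner_neq0 R); rewrite tofrac1 divr1 => ->.
by rewrite psi1 (_ : poly_ord 1 = 0%N) ?subr0 //; apply: poly_ord_eq; rewrite ?coef1 ?oner_neq0.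
Qed.

End FractionValuation.

Section QuotientMap.
Variables (K : fieldType) (n : nat) (G : sgraph n).
Local Notation S := {mpoly K[n * n]}.

Definition to_RG (f : S) : RG K G := (\pi_({ideal_quot (PG (K := K) G : idealr S)}) f)%qT.

Lemma to_RG_is_zmod : zmod_morphism to_RG.
Proof. by move=> x y; rewrite /to_RG rmorphB. Qed.

Lemma to_RG_is_monoid : monoid_morphism to_RG.
Proof. by split=> [|x y]; rewrite /to_RG ?rmorph1 ?rmorphM. Qed.

HB.instance Definition _ := GRing.isZmodMorphism.Build S (RG K G) to_RG to_RG_is_zmod.
HB.instance Definition _ := GRing.isMonoidMorphism.Build S (RG K G) to_RG to_RG_is_monoid.

Lemma to_RG_surj (x : RG K G) : exists f, x = to_RG f.
Proof. by exists (repr x); rewrite /to_RG reprK. Qed.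

Lemma to_RG_eq0 (f : S) : to_RG f = 0 <-> PG G f.
Proof.
rewrite -(rmorph0 to_RG); split=> [/eqP|Pf]; rewrite /to_RG.
  by rewrite -Quotient.idealrBE subr0.
by apply/eqP; rewrite -Quotient.idealrBE subr0.
Qed.

End QuotientMap.

Lemma mmap1_morph (N : nat) (A : comNzRingType) (phi : 'X_{1.. N} -> A) :
  phi 0%MM = 1 -> (forall m1 m2, phi (m1 + m2)%MM = phi m1 * phi m2) ->
  forall m, mmap1 (fun k => phi U_(k)%MM) m = phi m.
Proof.
move=> phi0 phiD m; rewrite /mmap1 {2}[m]multinomUE_id (big_morph phi phiD phi0).
apply: eq_bigr => k _; elim: (m k) => [|p IHp]; first by rewrite mulm0n phi0.
by rewrite mulmS phiD exprS IHp.
Qed.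

Definition mdot (N : nat) (w m : 'X_{1.. N}) : nat := \sum_(k < N) w k * m k.

Lemma mdotD N (w m1 m2 : 'X_{1.. N}) : mdot w (m1 + m2)%MM = (mdot w m1 + mdot w m2)%N.
Proof. by rewrite -big_split; apply: eq_bigr => k _; rewrite mnmDE mulnDr. Qed.

Lemma mdot0 N (w : 'X_{1.. N}) : mdot w 0%MM = 0%N.
Proof. by rewrite /mdot big1 // => k _; rewrite mnm0E muln0. Qed.

Section WeightedSubstitution.
Variables (K : fieldType) (n : nat) (G : sgraph n).
Local Notation S := {mpoly K[n * n]}.
Implicit Types (w m s : 'X_{1.. n * n}) (f g : S).

Definition wmonomial w m : {poly S} := 'X_[expo G m] *: 'X^(mdot w m).

Lemma wmonomial0 w : wmonomial w 0%MM = 1.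
Proof. by rewrite /wmonomial expo0 mdot0 mpolyX0 scale1r. Qed.

Lemma wmonomialD w m1 m2 : wmonomial w (m1 + m2)%MM = wmonomial w m1 * wmonomial w m2.
Proof. by rewrite /wmonomial expoD mdotD mpolyXD exprD -scalerAr -scalerAl scalerA mulrC. Qed.

(* The toric parametrization twisted by x_k |-> x_k t^(w k); its order in t is the
   monomial valuation of weight w. *)
Definition wsubst w : S -> {poly S} :=
  mmap (polyC \o @mpolyC _ K) (fun k => wmonomial w U_(k)%MM).

HB.instance Definition _ w := GRing.RMorphism.on (wsubst w).

Lemma wsubstX w m : wsubst w 'X_[m] = wmonomial w m.
Proof.
by rewrite /wsubst mmapX mmap1_morph //; [apply: wmonomial0|apply: wmonomialD].
Qed.

Lemma wsubstC w c : wsubst w c%:MP = (c%:MP)%:P.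
Proof. by rewrite /wsubst mmapC. Qed.

Definition balanced w := forall i j, adj G i j ->
  mdot w (Umx i i + Umx j j)%MM = mdot w (Umx i j + Umx j i)%MM.

(** The two monomials of a generator have the same [expo] and, by balance, the same power of t. *)
Lemma wsubst_PG w f : balanced w -> PG G f -> wsubst w f = 0.
Proof.
move=> wb /asboolP[c ->]; rewrite rmorph_sum big1 //= => i _.
rewrite rmorph_sum big1 //= => j /andP[_ ij].
rewrite rmorphM /= /diag_minor /xvar -!mpolyXD rmorphB /= !wsubstX /wmonomial.
by rewrite -/(Umx i i) -/(Umx j j) -/(Umx i j) -/(Umx j i) wb // expo_swap // subrr mulr0.
Qed.

Definition standard_poly f := forall m, m \in msupp f -> standard G m.

Lemma standard_repr f : exists2 g, standard_poly g & PG G (f - g).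
Proof.
have [nf nfP] := choice (to_standard K G).
exists (\sum_(m <- msupp f) f@_m *: 'X_[nf m]).
  move=> s; apply: contraPP => ns; apply/negP; rewrite mcoeff_msupp negbK raddf_sum /=.
  apply/eqP; rewrite big1 // => m _; rewrite mcoeffZ mcoeffX.
  have [e|_] := eqVneq (nf m) s; last by rewrite mulr0.
  by case: ns; rewrite -e; case: (nfP m).
rewrite {1}[f]mpolyE -sumrB.
elim/big_ind: _ => [||m _]; [exact: PG0|by move=> *; apply: PGD|].
by rewrite -scalerBr -mul_mpolyC; apply: PGM; case: (nfP m).
Qed.

(** No cancellation occurs, as [expo] is injective on standard monomials. Hence the order in t
    bounds from below the weight of every monomial of g. *)
Lemma wsubst_coef w g s : standard_poly g -> standard G s ->
  (wsubst w g)`_(mdot w s) @_(expo G s) = g@_s.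
Proof.
move=> std_g std_s; rewrite {1}[g]mpolyE rmorph_sum /= coef_sum raddf_sum /=.
rewrite [in RHS](mpolyE g) raddf_sum /= big_seq [RHS]big_seq; apply: eq_bigr => m /std_g std_m.
rewrite -mul_mpolyC rmorphM /= wsubstC wsubstX /wmonomial coefCM coefZ coefXn.
rewrite !mul_mpolyC !mcoeffZ mcoeffX; congr (_ * _).
have [->|neq_ms] := eqVneq m s; first by rewrite !eqxx mulr1 mcoeffX eqxx.
case: eqP => _; last by rewrite mulr0 mcoeff0.
rewrite mulr1 mcoeffX; have [e|//] := eqVneq (expo G m) (expo G s).
by rewrite (expo_inj_standard std_m std_s e) eqxx in neq_ms.
Qed.

Lemma wsubst_ker w f : balanced w -> wsubst w f = 0 -> PG G f.
Proof.
move=> wb wf; have [g std_g Pfg] := standard_repr f.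
have wg : wsubst w g = 0.
  by have := wsubst_PG wb Pfg; rewrite rmorphB /= wf sub0r => /eqP; rewrite oppr_eq0 => /eqP.
suff g0 : g = 0 by move: Pfg; rewrite g0 subr0.
apply/mpolyP => s; rewrite mcoeff0; apply/eqP; apply: contraT => gs.
have /std_g std_s : s \in msupp g by rewrite mcoeff_msupp.
by have := wsubst_coef w std_g std_s; rewrite wg coef0 mcoeff0 => /esym/eqP; rewrite (negPf gs).
Qed.

(** Computed on a chosen representative; for balanced [w] the choice does not matter. *)
Definition wsubst_RG w (x : RG K G) : {poly S} := wsubst w (repr x).

Lemma wsubst_RGE w f : balanced w -> wsubst_RG w (to_RG G f) = wsubst w f.
Proof.
move=> wb; apply/eqP; rewrite /wsubst_RG -subr_eq0 -rmorphB; apply/eqP/wsubst_PG => //.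
by apply/to_RG_eq0; rewrite rmorphB /= {1}/to_RG reprK subrr.
Qed.

Lemma wsubst_RG_D w : balanced w -> {morph wsubst_RG w : x y / x + y}.
Proof.
move=> wb x y; have [f ->] := to_RG_surj x; have [g ->] := to_RG_surj y.
by rewrite -rmorphD !wsubst_RGE // rmorphD.
Qed.

Lemma wsubst_RG_M w : balanced w -> {morph wsubst_RG w : x y / x * y}.
Proof.
move=> wb x y; have [f ->] := to_RG_surj x; have [g ->] := to_RG_surj y.
by rewrite -rmorphM !wsubst_RGE // rmorphM.
Qed.

Lemma wsubst_RG_inj w x : balanced w -> wsubst_RG w x = 0 -> x = 0.
Proof.
move=> wb; have [f ->] := to_RG_surj x; rewrite wsubst_RGE // => /(wsubst_ker wb) Pf.
exact/to_RG_eq0.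
Qed.

Lemma wsubst_RG_1 w : balanced w -> wsubst_RG w 1 = 1.
Proof. by move=> wb; rewrite -(rmorph1 (to_RG G)) wsubst_RGE // rmorph1. Qed.

Lemma balanced0 : balanced 0%MM.
Proof. by move=> i j _; rewrite /mdot !big1 // => k _; rewrite mnm0E mul0n. Qed.

End WeightedSubstitution.

(** * Facets of the semigroup and the class map *)

Section Facets.
Variables (n : nat) (G : sgraph n).
Local Notation at_ m a b := ((m : 'X_{1.. n * n}) (mxvec_index a b)).
Implicit Types (m s t : 'X_{1.. n * n}) (a b i j k l : 'I_n) (T : {set 'I_n}).
Implicit Types (u : 'I_n -> 'I_n -> int).

Definition nbrs i := [set j | adj G i j].

Lemma nbrs_irr i : i \notin nbrs i. Proof. by rewrite inE adj_irr. Qed.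

Definition mnm_of (f : 'I_n -> 'I_n -> nat) : 'X_{1.. n * n} :=
  [multinom mxvec (\matrix_(a, b) f a b) 0%R k | k < (n * n)].

Lemma mnm_ofE f a b : at_ (mnm_of f) a b = f a b.
Proof. by rewrite mnmE mxvecE mxE. Qed.

Lemma sum_mxvec_index (V : nmodType) (f : 'I_(n * n) -> V) :
  \sum_k f k = \sum_a \sum_b f (mxvec_index a b).
Proof.
have [g fK gK] := curry_mxvec_bij n n.
rewrite pair_bigA (reindex (uncurry (@mxvec_index n n))) /=; last first.
  by exists g => x _; [apply: fK|apply: gK].
by apply: eq_bigr => -[a b].
Qed.

(* [inl (i, T)] is the facet of the prime (x_ii, x_ij (j in T), x_ji (j in nbrs i \ T));
   [inr (k, l)] is the facet of the prime (x_kl) for a non-edge k != l. *)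
Definition facet_index := (('I_n * {set 'I_n}) + ('I_n * 'I_n))%type.

Definition is_facet (x : facet_index) : bool :=
  match x with
  | inl p => p.2 \subset nbrs p.1
  | inr p => (p.1 != p.2) && ~~ adj G p.1 p.2
  end.

Definition facet_entry (x : facet_index) a b : nat :=
  match x with
  | inl p => (((a == p.1) && ((b == p.1) || (b \in p.2))) +
              ((b == p.1) && (a \in nbrs p.1 :\: p.2)))%N
  | inr p => (a == p.1) && (b == p.2)
  end.

Definition facet_weight x : 'X_{1.. n * n} := mnm_of (facet_entry x).

(** Stated on integer matrices, so that it also evaluates quotients of monomials. *)
Definition facet_val x u : int := \sum_a \sum_b (facet_entry x a b)%:Z * u a b.

Lemma mdot_facet x m : (mdot (facet_weight x) m)%:Z = facet_val x (fun a b => at_ m a b).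
Proof.
rewrite /mdot (big_morph Posz PoszD (erefl _)) sum_mxvec_index.
by apply: eq_bigr => a _; apply: eq_bigr => b _; rewrite mnm_ofE PoszM.
Qed.

Lemma facet_valE i T u : T \subset nbrs i ->
  facet_val (inl (i, T)) u =
  u i i + \sum_(j in T) u i j + \sum_(j in nbrs i :\: T) u j i.
Proof.
move=> TN; have iT : i \notin T by apply: contra (nbrs_irr i); apply: (fintype.subsetP TN).
rewrite /facet_val /=.
under eq_bigr do under eq_bigr do rewrite PoszD mulrDl.
under eq_bigr do rewrite big_split.
rewrite big_split; congr (_ + _) => /=.
  rewrite (bigD1 i) //= [X in _ + X]big1 ?addr0 => [|a /negPf na].
    rewrite (bigD1 i) //= !eqxx mul1r; congr (_ + _).
    rewrite [RHS]big_mkcond [LHS]big_mkcond; apply: eq_bigr => b _.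
    have [->|_] /= := eqVneq b i; first by rewrite (negPf iT).
    by case: (b \in T); rewrite ?mul1r ?mul0r.
  by apply: big1 => b _; rewrite na mul0r.
rewrite exchange_big (bigD1 i) //= [X in _ + X]big1 ?addr0 => [|b /negPf nb].
  rewrite [RHS]big_mkcond; apply: eq_bigr => a _.
  by rewrite eqxx; case: ifP; rewrite ?mul1r ?mul0r.
by apply: big1 => a _; rewrite nb mul0r.
Qed.

Lemma facet_valB i T u : T \subset nbrs i ->
  facet_val (inl (i, T)) u =
  facet_val (inl (i, finset.set0)) u + \sum_(j in T) (u i j - u j i).
Proof.
move=> TN; rewrite !facet_valE ?finset.sub0set // big_set0 addr0 finset.setD0.
rewrite [\sum_(j in nbrs i) _](big_setID T) /= (finset.setIidPr TN) sumrB.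
by ring.
Qed.

Lemma facet_val_offdiag k l u : facet_val (inr (k, l)) u = u k l.
Proof.
rewrite /facet_val /= (bigD1 k) //= [X in _ + X]big1 ?addr0 => [|a /negPf na].
  rewrite (bigD1 l) //= !eqxx mul1r big1 ?addr0 // => b /negPf nb.
  by rewrite nb mul0r.
by apply: big1 => b _; rewrite na mul0r.
Qed.

Lemma mdotU w a b : mdot w (Umx a b) = at_ w a b.
Proof.
rewrite /mdot (bigD1 (mxvec_index a b)) //= big1 => [|k /negPf nk].
  by rewrite mnm1E eqxx muln1 addn0.
by rewrite mnm1E eq_sym nk muln0.
Qed.

(** On an edge {c, j} at the vertex c of the facet, exactly one of x_cj and x_jc has weight 1, as
    has x_cc, while x_jj has weight 0. All other edges have weight 0 on both sides. *)
Lemma facet_balanced x : is_facet x -> balanced G (facet_weight x).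
Proof.
move=> fx i j ij; rewrite !mdotD !mdotU !mnm_ofE.
have neq_ij : i != j by apply: contraTneq ij => ->; rewrite adj_irr.
have ji : adj G j i by rewrite adjC.
case: x fx => [[c T]|[c d]] /= fx; last first.
  move: fx => /andP[ncd nacd].
  case: (eqVneq i c) => [?|ic]; case: (eqVneq j c) => [?|jc];
    case: (eqVneq i d) => [?|id]; case: (eqVneq j d) => [?|jd] //=; subst;
    by move: neq_ij ncd nacd; rewrite ?eqxx ?ij ?ji.
have T_nb z : z \in T -> adj G c z by move=> /(fintype.subsetP fx); rewrite inE.
rewrite !inE.
have [ei|ni] := eqVneq i c; have [ej|nj] := eqVneq j c => //=.
- by rewrite -ei ij adj_irr andbF andbT; case: (j \in T).
- by rewrite -ej ji adj_irr andbF andbT; case: (i \in T).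
Qed.

Definition facet_top (x : facet_index) : 'X_{1.. n * n} :=
  match x with inl p => Umx p.1 p.1 | inr p => Umx p.1 p.2 end.

(** The product of all variables of value 0: a point in the relative interior of the facet. *)
Definition facet_interior x : 'X_{1.. n * n} :=
  mnm_of (fun a b => (facet_entry x a b == 0)%N).

Lemma facet_topE x : is_facet x -> mdot (facet_weight x) (facet_top x) = 1%N.
Proof.
case: x => [[c T]|[c d]] /= fx; rewrite mdotU mnm_ofE /= !eqxx //.
by rewrite !inE adj_irr andbF.
Qed.

Lemma facet_interior0 x : mdot (facet_weight x) (facet_interior x) = 0%N.
Proof.
rewrite /mdot big1 // => k _; case/mxvec_indexP: k => a b; rewrite !mnm_ofE.
by case: (facet_entry x a b) => [|k]; rewrite ?muln0.
Qed.

(** The variable is x_ee if y sits at a vertex e that is not the vertex of x, and x_ef if y is a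
    non-edge (e, f). For two facets at the same c, a j in exactly one of the two sets decides
    between x_jc and x_cj. *)
Lemma facet_separated x y : is_facet x -> is_facet y -> x != y ->
  exists a b, facet_entry x a b = 0%N /\ (0 < facet_entry y a b)%N.
Proof.
case: x y => [[c T]|[c d]] [[e U]|[e f]] /= fx fy neq.
- have [eec|nec] := eqVneq e c; last first.
    by exists e, e; rewrite !inE !eqxx (negPf nec) adj_irr !andbF.
  subst e; have [j neqj] : exists j, (j \in T) != (j \in U).
    apply: contrapT => /forallNP eTU; case/eqP: neq; congr (inl (_, _)).
    by apply/setP => j; apply/eqP; apply: contraT => nj; case: (eTU j).
  have jc : j != c.
    apply: contraNneq neqj => ->.
    by rewrite !(contraNF (fintype.subsetP _ _) (nbrs_irr c)).
  case: (boolP (j \in T)) (boolP (j \in U)) neqj => jT [] jU //= _.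
  + exists j, c; rewrite !inE eqxx (negPf jc) jT jU /=; split=> //.
    by have := fintype.subsetP fx _ jT; rewrite inE => ->.
  + exists c, j; rewrite !inE eqxx (negPf jc) (negPf jT) jU /=; split=> //.
- move: fy => /andP[nef naef]; exists e, f; rewrite !eqxx /=; split=> //.
  rewrite !inE; have [eec|nec] := eqVneq e c; have [efc|nfc] := eqVneq f c => //=.
  + by rewrite eec efc eqxx in nef.
  + rewrite addn0; case: (boolP (f \in T)) => // /(fintype.subsetP fx).
    by rewrite inE -eec (negPf naef).
  + by rewrite add0n -efc adjC (negPf naef) andbF.
- exists e, e; rewrite !eqxx /=; split=> //.
  have [eec|//] := eqVneq e c; have [eed|//] := eqVneq e d.
  by move: fx; rewrite -eec -eed eqxx.
- exists e, f; rewrite !eqxx /=; split=> //.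
  have [eec|//] := eqVneq e c; have [efd|//] := eqVneq f d.
  by move: neq; rewrite eec efd eqxx.
Qed.

Lemma facet_interior_gt0 x y : is_facet x -> is_facet y -> x != y ->
  (0 < mdot (facet_weight y) (facet_interior x))%N.
Proof.
move=> fx fy /(facet_separated fx fy)[a [b [xab yab]]].
rewrite /mdot (bigD1 (mxvec_index a b)) //= !mnm_ofE xab muln1.
by rewrite (leq_trans yab) // leq_addr.
Qed.

Lemma rowsum_nbrs m a : rowsum G m a = (at_ m a a + \sum_(b in nbrs a) at_ m a b)%N.
Proof.
rewrite /rowsum (bigD1 a) ?eqxx //=; congr (_ + _)%N; apply: eq_bigl => b.
by rewrite inE; have [->|] := eqVneq b a; rewrite ?adj_irr ?orbF ?andbT // andbF.
Qed.

(* Normality of the semigroup: s - m is brought to the form in which one of the two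
   exponents on each edge vanishes, and its i-th diagonal exponent is then the value of
   s - m on the facet (i, T) for T the set of neighbours where x_ij has exponent 0. *)
Lemma facet_normal m s :
  (forall x, is_facet x -> (mdot (facet_weight x) m <= mdot (facet_weight x) s)%N) ->
  exists t, expo G s = expo G (m + t)%MM.
Proof.
move=> le_ms.
pose u a b : int := (at_ s a b)%:Z - (at_ m a b)%:Z.
have u_ge0 x : is_facet x -> 0 <= facet_val x u.
  move=> /le_ms; rewrite -lez_nat !mdot_facet -subr_ge0 -sumrB; congr (0 <= _).
  by apply: eq_bigr => a _; rewrite -sumrB; apply: eq_bigr => b _; rewrite -mulrBr.
pose delta a b := u a b - u b a.
pose pos (z : int) : nat := if z is Posz k then k else 0%N.
have posE (z : int) : (pos z)%:Z = if 0 < z then z else 0 by case: z => [[|k]|k].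
have posP z : ((pos z)%:Z = z /\ 0 < z) \/ (pos z = 0%N /\ z <= 0).
  by case: z => [[|k]|k] /=; [right|left|right].
(* [T a] picks the smaller of u_ab and u_ba at each neighbour b, so (a, T a) has the least value
   among the facets at a. *)
pose T a := [set b in nbrs a | delta a b <= 0].
have TN a : T a \subset nbrs a by apply/fintype.subsetP => b; rewrite inE => /andP[].
pose diag a : int := u a a + \sum_(b in nbrs a) (u a b - (pos (delta a b))%:Z).
have diag_ge0 a : 0 <= diag a.
  suff -> : diag a = facet_val (inl (a, T a)) u by apply: u_ge0; apply: TN.
  rewrite facet_valE // /diag -[RHS]addrA; congr (_ + _).
  rewrite [LHS](big_setID (T a)) /= (finset.setIidPr (TN a)); congr (_ + _).
    by apply: eq_bigr => b; rewrite !inE posE => /andP[_]; rewrite leNgt => /negPf->; rewrite subr0.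
  apply: eq_bigr => b; rewrite !inE posE => /andP[+ ab]; rewrite ab /= -ltNge => ->.
  by rewrite /delta; ring.
pose t a b := if a == b then pos (diag a) else if adj G a b then pos (delta a b) else pos (u a b).
exists (mnm_of t).
have tN a b : b \in nbrs a -> t a b = pos (delta a b).
  rewrite inE /t => ab; rewrite ab; case: eqP => // eab.
  by move: ab; rewrite eab adj_irr.
(* [expo] sees the row sums, the differences across edges and the non-edge exponents. The diagonal
   of t was chosen to match the row sums; the other two match by construction. *)
have rs a : rowsum G (m + mnm_of t)%MM a = rowsum G s a.
  have rt : rowsum G (mnm_of t) a = (pos (diag a) + \sum_(b in nbrs a) pos (delta a b))%N.
    rewrite rowsum_nbrs mnm_ofE {1}/t eqxx; congr (_ + _)%N.
    by apply: eq_bigr => b /tN <-; rewrite mnm_ofE.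
  rewrite rowsumD rt !rowsum_nbrs.
  apply/eqP; rewrite -eqz_nat !PoszD.
  have -> : (pos (diag a))%:Z = diag a by rewrite posE; case: ltgtP (diag_ge0 a).
  rewrite !(big_morph Posz PoszD (erefl _)) /diag sumrB /u sumrB.
  by apply/eqP; ring.
apply: mnm_ext => a b; rewrite !expoE /expo_entry rs.
case: eqVneq => [//|neq_ab]; case: ifPn => nab.
  rewrite mnmDE mnm_ofE /t (negPf neq_ab) (negPf nab).
  have := u_ge0 (inr (a, b)); rewrite /= neq_ab nab facet_val_offdiag => /(_ isT).
  by have := posP (u a b); move: (pos (u a b)) => p; rewrite /u; lia.
have ab : adj G a b := negbNE nab; have ba : adj G b a by rewrite adjC.
case: ifP => // _; rewrite rs !mnmDE !mnm_ofE !tN ?inE //.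
have := @le_rowsum n G s b a; have := @le_rowsum n G (m + mnm_of t)%MM b a.
rewrite rs !mnmDE !mnm_ofE tN ?inE // => /(_ ba) h1 /(_ ba) h2.
have := posP (delta a b); have := posP (delta b a); move: h1 h2.
move: (pos (delta a b)) (pos (delta b a)) => p1 p2; rewrite /delta /u.
lia.
Qed.

End Facets.

(** * Counting the free facets *)

Section FreeIndices.
Variables (n : nat) (G : sgraph n).
Implicit Types (i j : 'I_n) (T : {set 'I_n}).

Definition free_indices : {set 'I_n * {set 'I_n}} :=
  [set p : 'I_n * {set 'I_n} | [&& p.2 \subset nbrs G p.1, p.2 != finset.set0
             & ~~ [exists j : 'I_n, (p.1 < j)%N && (p.2 == [set j])]]].

Lemma card_nbrs i : #|nbrs G i| = degree G i.
Proof.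
rewrite /degree -(card_in_imset (f := fun j => [set i; j]) (D := nbrs G i)); last first.
  move=> j k; rewrite !inE => ij ik /setP/(_ j); rewrite !inE eqxx orbT => /esym/orP[|] /eqP //.
  by move=> eji; rewrite eji adj_irr in ij.
apply: eq_card => e; rewrite inE; apply/imsetP/andP.
  by move=> [j]; rewrite inE => ij ->; rewrite set21.
move=> [eE ie]; have /eqP/cards2P[a [b [nab eab]]] := card_edges eE.
move: ie; rewrite eab !inE => /orP[] /eqP ei.
  by rewrite ei; exists b => //; rewrite inE /adj -eab.
by rewrite ei; exists a; rewrite ?inE /adj finset.setUC // -eab.
Qed.

(** Each edge is counted once, at its smaller endpoint. *)
Lemma card_upper_nbrs : (\sum_i #|[set j in nbrs G i | (i < j)%N]|)%N = #|edges G|.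
Proof.
transitivity #|[set p : 'I_n * 'I_n | adj G p.1 p.2 && (p.1 < p.2)%N]|.
  under eq_bigr do rewrite -sum1_card.
  by rewrite pair_big_dep -sum1_card; apply: eq_bigl => p; rewrite !inE.
rewrite -(card_in_imset (f := fun p : 'I_n * 'I_n => [set p.1; p.2])); last first.
  move=> [a b] [c d]; rewrite !inE /= => /andP[_ ab] /andP[_ cd] e.
  have /setP/(_ a) := e; have /setP/(_ b) := e; rewrite !inE !eqxx ?orbT /= => /esym hb /esym ha.
  have /orP[/eqP ea|/eqP ea] := ha; have /orP[/eqP eb|/eqP eb] := hb.
  - by move: ab; rewrite ea eb ltnn.
  - by rewrite ea eb.
  - by move: ab; rewrite ea eb ltnNge ltnW.
  - by move: ab; rewrite ea eb ltnn.
apply: eq_card => e; apply/imsetP/idP => [[[a b]]|eE].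
  by rewrite inE /= => /andP[ab _] ->.
have /eqP/cards2P[a [b [nab eab]]] := card_edges eE.
have [lt|lt|/ord_inj eqab] := ltngtP a b; last by rewrite eqab eqxx in nab.
  by exists (a, b); rewrite // inE /= lt /adj -eab eE.
by exists (b, a); rewrite /= ?(finset.setUC [set b]) // inE /= lt /adj finset.setUC -eab eE.
Qed.

(** At each vertex i the subsets of [nbrs G i] are the free ones, the empty set, and the singletons
    {j} with j > i; the last two kinds add up to n and to the number of edges. *)
Lemma card_free_indices :
  (#|free_indices| + n + #|edges G|)%N = (\sum_(i < n) 2 ^ degree G i)%N.
Proof.
have -> : #|free_indices| = (\sum_i #|[set T | (i, T) \in free_indices]|)%N.
  under [RHS]eq_bigr do rewrite -sum1_card.
  by rewrite pair_big_dep -sum1_card; apply: eq_bigl => -[i T]; rewrite !inE.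
rewrite -card_upper_nbrs -[X in (_ + X + _)%N](card_ord n) -sum1_card -!big_split.
apply: eq_bigr => i _ /=; rewrite -card_nbrs -[X in (_ + X)%N = _](card_imset _ (@set1_inj _)) -card_powerset.
set A := [set T | (i, T) \in free_indices]; set B := [set _ | _ in _].
have BP T : reflect (exists2 j, adj G i j & (i < j)%N /\ T = [set j]) (T \in B).
  apply: (iffP imsetP) => -[j]; first by rewrite !inE => /andP[ij lt] ->; exists j.
  by move=> ij [lt ->]; exists j; rewrite // !inE ij lt.
have -> : powerset (nbrs G i) = finset.set0 |: (A :|: B).
  apply/setP => T; rewrite !inE /=; have [->|nT0] /= := eqVneq T finset.set0.
    by rewrite finset.sub0set.
  apply/idP/orP => [TN|[/andP[] //|/BP[j ij [_ ->]]]]; last by rewrite finset.sub1set inE.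
  rewrite TN /=; case: existsP => [[j /andP[lt /eqP eT]]|_]; [right|by left].
  by apply/BP; exists j => //; move: TN; rewrite eT finset.sub1set inE.
rewrite cardsU1 cardsU !inE /= eqxx !andbF /=.
have -> : finset.set0 \in B = false.
  by apply/negP => /BP[j _ [_ /setP/(_ j)]]; rewrite !inE eqxx.
have -> : A :&: B = finset.set0.
  apply/setP => T; rewrite !inE /=; apply/negP => /andP[/and3P[_ _ /existsP nex]].
  by move=> /BP[j _ [lt eT]]; apply: nex; exists j; rewrite lt eT eqxx.
by rewrite cards0 subn0 addnAC addnC.
Qed.

End FreeIndices.

(** * The cokernel of the facet values *)

Section ClassMap.
Variables (n : nat) (G : sgraph n).
Implicit Types (i j : 'I_n) (T : {set 'I_n}) (x : facet_index n).

Definition facet := {x : facet_index n | is_facet G x}.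
Implicit Types (d : facet -> int).

(** Extends [d] by 0, so that formulas can name a facet by its raw index without a proof. *)
Definition facet_lookup d x : int := if insub x is Some f then d f else 0.

Lemma facet_lookupE d (f : facet) : facet_lookup d (val f) = d f.
Proof. by rewrite /facet_lookup valK. Qed.

Lemma facet_lookup_sub d x (fx : is_facet G x) : facet_lookup d x = d (Sub x fx).
Proof. by rewrite /facet_lookup insubT. Qed.

Lemma facet_lookupD d1 d2 x :
  facet_lookup (fun f => d1 f + d2 f) x = facet_lookup d1 x + facet_lookup d2 x.
Proof. by rewrite /facet_lookup; case: insubP. Qed.

(* For d = facet_val u this is u_ij - u_ji. *)
Definition slope d i j : int :=
  if (i < j)%N then facet_lookup d (inl (i, [set j])) - facet_lookup d (inl (i, finset.set0))
  else facet_lookup d (inl (j, finset.set0)) - facet_lookup d (inl (j, [set i])).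

(** The failure of [d] to satisfy the linear relation between (i, T) and the base facets; it
    vanishes when [d] comes from an exponent matrix. *)
Definition excess d i T : int :=
  facet_lookup d (inl (i, T)) - facet_lookup d (inl (i, finset.set0))
  - \sum_(j in T) slope d i j.

Definition class_map d : 'rV[int]_#|free_indices G| :=
  \row_k excess d (enum_val k).1 (enum_val k).2.

Lemma class_mapD d1 d2 : class_map (fun f => d1 f + d2 f) = class_map d1 + class_map d2.
Proof.
apply/rowP => k; rewrite !mxE /excess !facet_lookupD.
rewrite (eq_bigr (fun j => slope d1 (enum_val k).1 j + slope d2 (enum_val k).1 j)).
  by rewrite big_split /=; ring.
by move=> j _; rewrite /slope !facet_lookupD; case: ifP => _; ring.
Qed.

Lemma facet_set0 i : is_facet G (inl (i, finset.set0)).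
Proof. exact: finset.sub0set. Qed.

Lemma facet_set1 i j : adj G i j -> is_facet G (inl (i, [set j])).
Proof. by move=> ij; rewrite /= finset.sub1set inE. Qed.

Lemma excess_free d : class_map d = 0 ->
  forall i T, (i, T) \in free_indices G -> excess d i T = 0.
Proof.
move=> d0 i T iT; have := congr1 (fun z : 'rV__ => z 0 (enum_rank_in iT (i, T))) d0.
by rewrite !mxE enum_rankK_in.
Qed.

(** Off the free indices the excess vanishes by the very definition of [slope]. *)
Lemma excess_eq0 d : class_map d = 0 -> forall i T, T \subset nbrs G i -> excess d i T = 0.
Proof.
move=> d0 i T TN; have [->|T0] := eqVneq T finset.set0.
  by rewrite /excess subrr big_set0 subr0.
have [/existsP[j /andP[ij /eqP ->]]|nT] :=
    boolP [exists j : 'I_n, (i < j)%N && (T == [set j])].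
  by rewrite /excess big_set1 /slope ij subrr.
by apply: excess_free; rewrite // inE /= TN T0.
Qed.

Lemma class_map_val (u : 'I_n -> 'I_n -> int) :
  class_map (fun f => facet_val G (val f) u) = 0.
Proof.
have lk x : is_facet G x -> facet_lookup (fun f => facet_val G (val f) u) x = facet_val G x u.
  by move=> fx; rewrite facet_lookup_sub.
apply/rowP => k; rewrite !mxE; have := enum_valP k.
case: (enum_val k) => i T; rewrite inE => /and3P[/= TN _ _]; rewrite /excess.
rewrite !lk ?facet_set0 // (facet_valB u TN) [X in X - _ - _]addrC addrK; apply/eqP.
rewrite subr_eq0; apply/eqP; apply: eq_bigr => j jT.
have ij : adj G i j by have := fintype.subsetP TN j jT; rewrite inE.
have ji : adj G j i by rewrite adjC.
rewrite /slope; case: ifP => _; rewrite !lk ?facet_set0 ?facet_set1 //.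
  by rewrite (@facet_valB _ G i [set j] u (facet_set1 ij)) big_set1; ring.
by rewrite (@facet_valB _ G j [set i] u (facet_set1 ji)) big_set1; ring.
Qed.

Lemma class_map_ker d : class_map d = 0 -> exists u, forall f : facet, d f = facet_val G (val f) u.
Proof.
move=> d0.
(* On an edge the difference u_ij - u_ji is prescribed, so the entry with i < j takes the whole
   slope and the other is 0. The diagonal then corrects the value at (i, set0), whose off-diagonal
   part is the sum of the u_ki. *)
pose c i j : int := if adj G i j then if (i < j)%N then slope d i j else 0
                    else facet_lookup d (inr (i, j)).
pose u i j : int := if i == j then facet_lookup d (inl (i, finset.set0)) - \sum_(k in nbrs G i) c k i
                    else c i j.
have uE i j : i != j -> u i j = c i j by rewrite /u => /negPf->.
exists u => -[[[i T]|[k l]] fx] /=; rewrite -facet_lookupE /=; last first.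
  move: fx => /= /andP[nkl nakl]; rewrite facet_val_offdiag uE // /c (negPf nakl).
  by [].
have := excess_eq0 d0 fx; rewrite /excess => /eqP; rewrite !subr_eq0 subr_eq => /eqP ->.
rewrite (facet_valB u fx) addrC; congr (_ + _).
  rewrite (@facet_valE _ G _ _ u) ?finset.sub0set // big_set0 addr0 finset.setD0 /u eqxx.
  rewrite [X in _ + X](eq_bigr (fun k => c k i)) ?subrK // => k.
  by rewrite inE => ik; case: eqP => // eki; move: ik; rewrite eki adj_irr.
apply: eq_bigr => j jT.
have ij : adj G i j by have := fintype.subsetP fx j jT; rewrite inE.
have nij : i != j by apply: contraTneq ij => ->; rewrite adj_irr.
have ji : adj G j i by rewrite adjC.
rewrite !uE // 1?eq_sym // /c ij ji.
case: (ltngtP i j) => [lt|lt|/ord_inj eij]; last by rewrite eij eqxx in nij.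
  by rewrite subr0.
by rewrite sub0r /slope lt ltnNge ltnW //= opprB.
Qed.

(** A vector supported on the free facets vanishes on the base facets, so its slopes are 0 and its
    excess is the vector itself. *)
Lemma class_map_surj z : exists d, class_map d = z.
Proof.
pose d (f : facet) : int :=
  if val f is inl p then \sum_(k | enum_val k == p) z 0 k else 0.
have dl i T : facet_lookup d (inl (i, T)) =
    if T \subset nbrs G i then \sum_(k | enum_val k == (i, T)) z 0 k else 0.
  case: ifPn => TN; first by rewrite (@facet_lookup_sub d (inl (i, T)) TN).
  by rewrite /facet_lookup insubF //; apply: negPf.
have d0 i T : (i, T) \notin free_indices G -> facet_lookup d (inl (i, T)) = 0.
  move=> niT; rewrite dl; case: ifP => // _; apply: big1 => k /eqP ek.
  by have := enum_valP k; rewrite ek (negPf niT).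
exists d; apply/rowP => k; rewrite mxE.
have := enum_valP k; case ek: (enum_val k) => [i T] /= iT.
have free0 (a : 'I_n) : (a, finset.set0) \notin free_indices G by rewrite inE /= eqxx andbF.
have free1 (a b : 'I_n) : (a < b)%N -> (a, [set b]) \notin free_indices G.
  move=> lt; rewrite inE /=; apply/and3P => -[_ _ /existsP[]].
  by exists b; rewrite lt eqxx.
have sl j : j \in T -> slope d i j = 0.
  move=> jT; have nij : i != j.
    apply: contraTneq jT => <-; move: iT; rewrite inE /= => /andP[/fintype.subsetP TN _].
    by apply: contra (nbrs_irr G i); apply: TN.
  rewrite /slope; case: ltngtP => [lt|lt|/ord_inj eij]; rewrite !d0 ?subrr ?free1 //.
  by rewrite eij eqxx in nij.
rewrite /excess (big1 _ (fun j => j \in T)) => [|j /sl //]; rewrite (d0 i finset.set0) // !subr0.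
rewrite dl; move: (iT); rewrite inE => /andP[/= -> _].
rewrite (bigD1 k) ?ek //= big1 ?addr0 // => l /andP[/eqP el nlk].
by case/eqP: nlk; apply: enum_val_inj; rewrite el ek.
Qed.

End ClassMap.

(** * The Laurent polynomial ring *)

Section MonomialDivisors.

(** Size and order are both additive, up to the shift of size by 1. They are as close as possible
    for the product, hence for each factor. *)
Lemma poly_monomial_divisor (D : idomainType) (p q : {poly D}) (c : D) k :
  c != 0 -> p * q = c *: 'X^k ->
  p = lead_coef p *: 'X^(poly_ord p) /\ lead_coef p * lead_coef q = c.
Proof.
move=> c0 e; have pq0 : p * q != 0 by rewrite e -size_poly_gt0 size_scale // size_polyXn.
have [p0 q0] : p != 0 /\ q != 0 by move: pq0; rewrite mulf_eq0 negb_or => /andP.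
split; last by rewrite -lead_coefM e lead_coefZ lead_coefXn mulr1.
have szp : (poly_ord p < size p)%N.
  by rewrite ltnNge; apply: contra (poly_ord_neq0 p0) => /(nth_default 0)->.
have szq : (poly_ord q < size q)%N.
  by rewrite ltnNge; apply: contra (poly_ord_neq0 q0) => /(nth_default 0)->.
have szpq : (size p + size q).-1 = k.+1.
  by rewrite -size_mul // e size_scale // size_polyXn.
have ordpq : (poly_ord p + poly_ord q)%N = k.
  rewrite -poly_ordM // e; apply: poly_ord_eq => [|i lti].
    by rewrite coefZ coefXn eqxx mulr1.
  by rewrite coefZ coefXn ltn_eqF // mulr0.
have eqp : size p = (poly_ord p).+1 by lia.
apply/polyP => i; rewrite coefZ coefXn; case: ltngtP => [lti|gti|->].
- by rewrite mulr0 poly_ord_before.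
- by rewrite mulr0 nth_default // eqp.
- by rewrite mulr1 lead_coefE eqp.
Qed.

(** Induction through [muni]: in the last variable both factors are monomials, and their leading
    coefficients multiply to a monomial in the remaining variables. *)
Lemma mpoly_monomial_divisor (K : fieldType) N (a b : {mpoly K[N]}) (c : K) m :
  c != 0 -> a * b = c *: 'X_[m] -> exists2 z, z != 0 & exists e, a = z *: 'X_[e].
Proof.
move=> c0; elim: N a b m => [|N IHN] a b m e.
  have ea : a = (a@_0%MM)%:MP.
    by apply/mpolyP => s; rewrite mcoeffC (_ : s = 0%MM) ?eqxx ?mulr1 //; apply/mnmP; case.
  exists a@_0%MM; last by exists 0%MM; rewrite mpolyX0 alg_mpolyC.
  apply: contra_neq c0 => a0; move: e; rewrite ea a0 mpolyC0 mul0r => /(congr1 (mcoeff m)).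
  by rewrite mcoeff0 mcoeffZ mcoeffX eqxx mulr1.
pose m' := [multinom m (widen_ord (leqnSn N) i) | i < N].
have e' : muni a * muni b = (c *: 'X_[m']) *: 'X^(m ord_max).
  by rewrite -muniM e muniZ muniE msuppX big_seq1 mcoeffX eqxx scale1r scalerA mul_mpolyC.
have cm0 : c *: ('X_[m'] : {mpoly K[N]}) != 0.
  by apply: contra_neq c0 => /(congr1 (mcoeff m')); rewrite mcoeff0 mcoeffZ mcoeffX eqxx mulr1.
have [ea el] := poly_monomial_divisor cm0 e'.
have [z z0 [s es]] := IHN _ _ _ el.
exists z => //; exists (mnmwiden s + U_(ord_max) *+ poly_ord (muni a))%MM.
move: (poly_ord (muni a)) ea => k ea.
rewrite -[LHS]muniK ea es -mul_polyC rmorphM rmorphXn /= of_uniC of_uniX.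
by rewrite mwidenZ mwidenX mpolyXD -mpolyXn scalerAl.
Qed.

End MonomialDivisors.

(** * Localization of a factorial domain inside a field *)

Section Localization.
Variables (A : idomainType) (F : fieldType) (kappa : {rmorphism A -> F}) (M : A -> Prop).
Hypothesis kappa_inj : forall a, kappa a = 0 -> a = 0.
Hypothesis M1 : M 1.
Hypothesis MM : forall a b, M a -> M b -> M (a * b).
Hypothesis M_neq0 : forall a, M a -> a != 0.

Definition localized (x : F) := exists a m, M m /\ x = kappa a / kappa m.

Let kappa_neq0 a : a != 0 -> kappa a != 0.
Proof. by apply: contraNneq => /kappa_inj->. Qed.

Lemma localized_kappa a : localized (kappa a).
Proof. by exists a, 1; rewrite rmorph1 divr1. Qed.

Lemma localized1 : localized 1.
Proof. by rewrite -(rmorph1 kappa); apply: localized_kappa. Qed.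

Lemma localizedM x y : localized x -> localized y -> localized (x * y).
Proof.
move=> [a [m [Mm ->]]] [b [k [Mk ->]]]; exists (a * b), (m * k).
by split; [apply: MM|rewrite mulf_div !rmorphM].
Qed.

Lemma localizedD x y : localized x -> localized y -> localized (x + y).
Proof.
move=> [a [m [Mm ->]]] [b [k [Mk ->]]]; exists (a * k + b * m), (m * k).
by split; [apply: MM|rewrite addf_div ?kappa_neq0 ?M_neq0 // rmorphD !rmorphM].
Qed.

Lemma localized_inv a m b : M m -> m = a * b -> localized (kappa a)^-1.
Proof.
move=> Mm e; have := M_neq0 Mm; rewrite e mulf_eq0 negb_or => /andP[a0 b0].
exists b, m; split => //; rewrite e rmorphM invfM mulrCA mulfV ?mulr1 //.
exact: kappa_neq0.
Qed.

Lemma localized_M_unit m : M m -> unit_in localized (kappa m).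
Proof.
move=> Mm; split; [exact/kappa_neq0/M_neq0|exact: localized_kappa|].
by apply: (@localized_inv m m 1); rewrite ?mulr1.
Qed.

Lemma unit_inM x y :
  unit_in localized x -> unit_in localized y -> unit_in localized (x * y).
Proof.
move=> [x0 Tx Txi] [y0 Ty Tyi]; split; first by rewrite mulf_neq0.
  exact: localizedM.
by rewrite invfM; apply: localizedM.
Qed.

Lemma unit_inV x : unit_in localized x -> unit_in localized x^-1.
Proof. by move=> [x0 Tx Txi]; split; rewrite ?invr_neq0 ?invrK. Qed.

(** If p divides an element of [M] it becomes a unit. Otherwise clearing denominators gives p | a b
    l with l in [M], and p divides a or b. *)
Lemma localized_prime p : prime_elt p -> prime_in localized (kappa p).
Proof.
move=> [p0 _ pP]; split; [exact: kappa_neq0|exact: localized_kappa|].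
have [[m [c [Mm em]]] a b Ta _ _|nM] := pselect (exists m c, M m /\ m = p * c).
  by left; apply: localizedM Ta _; apply: localized_inv Mm em.
move=> _ _ [a [m [Mm ->]]] [b [k [Mk ->]]] [c [l [Ml e]]].
have e' : a * b * l = p * (c * (m * k)).
  apply/eqP; rewrite -subr_eq0; apply/eqP/kappa_inj; rewrite rmorphB !rmorphM /=.
  have [m0 k0 l0] : [/\ kappa m != 0, kappa k != 0 & kappa l != 0].
    by split; apply/kappa_neq0/M_neq0.
  have kp0 := kappa_neq0 p0.
  apply/eqP; rewrite subr_eq0; apply/eqP.
  transitivity ((kappa a / kappa m * (kappa b / kappa k) / kappa p) *
                (kappa p * kappa m * kappa k * kappa l)).
    by field; rewrite m0 k0 kp0.
  by rewrite e; field; rewrite l0.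
have : rdvd p (a * b * l) by exists (c * (m * k)).
have divp d s : M s -> rdvd p d -> localized (kappa d / kappa s / kappa p).
  move=> Ms [x ->]; exists x, s; split => //; rewrite rmorphM.
  have s0 : kappa s != 0 by apply/kappa_neq0/M_neq0.
  by field; rewrite s0 kappa_neq0.
move=> /pP[/pP[pa|pb]|[x ex]]; [left|right|]; try exact: divp.
by case: nM; exists l, x.
Qed.

Lemma localization_factorial : factorial A -> factorial_in localized.
Proof.
move=> facA x [a [m [Mm ->]]] x0.
have a0 : a != 0 by apply: contraNneq x0 => ->; rewrite rmorph0 mul0r.
have [u [s [uu sP ea]]] := facA a a0.
exists (kappa u / kappa m), (map kappa s); split.
- apply: unit_inM; last exact/unit_inV/localized_M_unit.
  split; [exact/kappa_neq0/unit_neq0|exact: localized_kappa|].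
  by rewrite -rmorphV //; apply: localized_kappa.
- by move=> _ /mapP[p /sP pP ->]; apply: localized_prime.
- by rewrite ea rmorphM rmorph_prod big_map mulrAC.
Qed.

End Localization.

(** * Laurent polynomials inside the fraction field of [RG] *)

Section ToricEmbedding.
Variables (K : fieldType) (n : nat) (G : sgraph n).
Local Notation S := {mpoly K[n * n]}.
Local Notation F := {fraction (RG K G)}.

Definition to_frac (f : S) : F := FracField.tofrac (to_RG G f).

Lemma to_frac_is_zmod : zmod_morphism to_frac.
Proof. by move=> f g; rewrite /to_frac rmorphB tofracB. Qed.

Lemma to_frac_is_monoid : monoid_morphism to_frac.
Proof. by split=> [|f g]; rewrite /to_frac ?rmorph1 ?tofrac1 ?rmorphM ?tofracM. Qed.

HB.instance Definition _ := GRing.isZmodMorphism.Build S F to_frac to_frac_is_zmod.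
HB.instance Definition _ := GRing.isMonoidMorphism.Build S F to_frac to_frac_is_monoid.

Lemma to_frac_eq0 f : to_frac f = 0 <-> PG G f.
Proof.
split=> [/eqP|/to_RG_eq0 e]; last by rewrite /to_frac e tofrac0.
by rewrite /to_frac tofrac_eq0 => /eqP/to_RG_eq0.
Qed.

Lemma in_base_to_frac f : in_base (to_frac f).
Proof. by exists (to_RG G f). Qed.

Lemma in_base_frac x : in_base x -> exists f, x = to_frac f.
Proof. by move=> [r ->]; have [f ->] := to_RG_surj r; exists f. Qed.

(* A set of variables on which the presentation has no relation: one of each pair
   x_ij, x_ji with {i, j} an edge is left out. *)
Definition gen_indices : {set 'I_n * 'I_n} :=
  [set p : 'I_n * 'I_n | ~~ adj G p.1 p.2 || (p.1 < p.2)%N].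

Local Notation A := {mpoly K[#|gen_indices|]}.
Implicit Types (k : 'I_#|gen_indices|) (m : 'X_{1.. #|gen_indices|}).

Definition gen_var k : 'I_(n * n) := mxvec_index (enum_val k).1 (enum_val k).2.

Lemma gen_var_inj : injective gen_var.
Proof.
move=> k l /eqP; rewrite /gen_var idx_eq => /andP[/eqP e1 /eqP e2].
by apply: enum_val_inj; rewrite [enum_val k]surjective_pairing e1 e2 -surjective_pairing.
Qed.

Definition gen_mnm m : 'X_{1.. n * n} :=
  [multinom (\sum_(k | gen_var k == l) m k)%N | l < (n * n)].

Lemma gen_mnm_var m k : gen_mnm m (gen_var k) = m k.
Proof.
rewrite mnmE (bigD1 k) //= big1 ?addn0 // => l /andP[/eqP/gen_var_inj -> /eqP].
by [].
Qed.

Lemma gen_mnm0 : gen_mnm 0%MM = 0%MM.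
Proof. by apply/mnmP => l; rewrite !mnmE big1 // => k _; rewrite mnm0E. Qed.

Lemma gen_mnmD m1 m2 : gen_mnm (m1 + m2)%MM = (gen_mnm m1 + gen_mnm m2)%MM.
Proof.
by apply/mnmP => l; rewrite mnmDE !mnmE -big_split; apply: eq_bigr => k _; rewrite mnmDE.
Qed.

Lemma gen_mnmU k : gen_mnm U_(k)%MM = U_(gen_var k)%MM.
Proof.
apply/mnmP => l; rewrite mnmE mnm1E; have [<-|nkl] := eqVneq (gen_var k) l.
  rewrite (bigD1 k) //= mnm1E eqxx big1 // => j /andP[/eqP/gen_var_inj -> /eqP].
  by [].
rewrite big1 // => j /eqP ej; rewrite mnm1E; case: eqP => // ekj.
by rewrite ekj ej eqxx in nkl.
Qed.

Lemma gen_mnm_inj : injective gen_mnm.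
Proof. by move=> m1 m2 e; apply/mnmP => k; rewrite -!gen_mnm_var e. Qed.

Lemma gen_mnm_standard m : standard G (gen_mnm m).
Proof.
have z a b : adj G a b -> ~~ (a < b)%N -> gen_mnm m (mxvec_index a b) = 0%N.
  move=> ab nlt; rewrite mnmE big1 // => k /eqP/eqP; rewrite /gen_var idx_eq => /andP[/eqP ea /eqP eb].
  by have := enum_valP k; rewrite inE ea eb ab (negPf nlt).
move=> a b ab; have [lt|le] := ltnP a b.
  by rewrite [X in _ || (X == _)]z ?eqxx ?orbT // 1?adjC // -leqNgt ltnW.
by rewrite z ?eqxx // -leqNgt.
Qed.

Definition gen_emb : A -> S := mmap (@mpolyC _ K) (fun k => 'X_[gen_mnm U_(k)%MM]).

HB.instance Definition _ := GRing.RMorphism.on gen_emb.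

Lemma gen_embX m : gen_emb 'X_[m] = 'X_[gen_mnm m].
Proof.
rewrite /gen_emb mmapX (mmap1_morph (phi := fun m => 'X_[gen_mnm m] : S)) //.
  by rewrite gen_mnm0 mpolyX0.
by move=> m1 m2; rewrite gen_mnmD mpolyXD.
Qed.

Lemma gen_embE (a : A) : gen_emb a = \sum_(m <- msupp a) a@_m *: 'X_[gen_mnm m].
Proof.
rewrite {1}[a]mpolyE rmorph_sum; apply: eq_bigr => m _ /=.
by rewrite /gen_emb mmapZ -/(gen_emb _) gen_embX mul_mpolyC.
Qed.

Lemma gen_emb_coef (a : A) m : (gen_emb a)@_(gen_mnm m) = a@_m.
Proof.
rewrite gen_embE [in RHS](mpolyE a) !raddf_sum; apply: eq_bigr => l _ /=.
by rewrite !mcoeffZ !mcoeffX (inj_eq gen_mnm_inj).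
Qed.

Lemma gen_emb_standard (a : A) : standard_poly G (gen_emb a).
Proof.
move=> s; rewrite mcoeff_msupp gen_embE raddf_sum /= => ns.
have [m es] : exists m, s = gen_mnm m.
  apply: contrapT => /forallNP nm; case/eqP: ns; apply: big1 => m _.
  by rewrite mcoeffZ mcoeffX; case: eqP => [/esym/nm//|_]; rewrite mulr0.
by rewrite es; apply: gen_mnm_standard.
Qed.

Definition kappa : A -> F := to_frac \o gen_emb.

HB.instance Definition _ := GRing.RMorphism.on kappa.

(** Monomials in the chosen variables are standard, so the parametrization recovers their
    coefficients: these variables are algebraically independent in [RG]. *)
Lemma kappa_inj a : kappa a = 0 -> a = 0.
Proof.
move=> /to_frac_eq0/(wsubst_PG (@balanced0 n G)) e; apply/mpolyP => m; rewrite mcoeff0.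
rewrite -gen_emb_coef -(wsubst_coef 0%MM (@gen_emb_standard a) (gen_mnm_standard m)) e.
by rewrite coef0 mcoeff0.
Qed.

Definition monomial_in (p : A) := exists m, p = 'X_[m].

Lemma monomial_in1 : monomial_in 1. Proof. by exists 0%MM; rewrite mpolyX0. Qed.

Lemma monomial_inM p q : monomial_in p -> monomial_in q -> monomial_in (p * q).
Proof. by move=> [m ->] [l ->]; exists (m + l)%MM; rewrite mpolyXD. Qed.

Lemma monomial_neq0 (N : nat) (m : 'X_{1.. N}) : 'X_[m] != 0 :> {mpoly K[N]}.
Proof.
apply/eqP => /(congr1 (mcoeff m)); rewrite mcoeffX eqxx mcoeff0 => /eqP.
by rewrite oner_eq0.
Qed.

Lemma monomial_in_neq0 p : monomial_in p -> p != 0.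
Proof. by move=> [m ->]; apply: monomial_neq0. Qed.

(* The Laurent polynomial ring on the semigroup of RG. *)
Definition laurent : F -> Prop := localized kappa monomial_in.

Lemma laurent_factorial : factorial_in laurent.
Proof.
apply: localization_factorial; [exact: kappa_inj|exact: monomial_in1|exact: monomial_inM| |].
  exact: monomial_in_neq0.
exact: factorial_mpoly.
Qed.

Definition mon (m : 'X_{1.. n * n}) : F := to_frac 'X_[m].

Lemma mon0 : mon 0%MM = 1. Proof. by rewrite /mon mpolyX0 rmorph1. Qed.

Lemma monD (m1 m2 : 'X_{1.. n * n}) : mon (m1 + m2)%MM = mon m1 * mon m2.
Proof. by rewrite /mon mpolyXD rmorphM. Qed.

Lemma mon_expo (m1 m2 : 'X_{1.. n * n}) : expo G m1 = expo G m2 -> mon m1 = mon m2.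
Proof.
move=> e; apply/eqP; rewrite /mon -subr_eq0 -rmorphB; apply/eqP/to_frac_eq0/PG_ker.
by rewrite /toric_subst rmorphB /= -/(toric_subst G 'X_[m1]) -/(toric_subst G 'X_[m2]) !substX e subrr.
Qed.

Lemma mon_neq0 (m : 'X_{1.. n * n}) : mon m != 0.
Proof.
apply/eqP => /to_frac_eq0/subst_PG; rewrite substX => /eqP.
by rewrite (negPf (monomial_neq0 _)).
Qed.

Lemma mon_gen m : mon (gen_mnm m) = kappa 'X_[m].
Proof. by rewrite /kappa /= gen_embX. Qed.

Lemma laurent_unit_gen a b : (a, b) \in gen_indices -> unit_in laurent (mon (Umx a b)).
Proof.
move=> ab; have -> : mon (Umx a b) = kappa 'X_[U_(enum_rank_in ab (a, b))].
  by rewrite -mon_gen gen_mnmU /gen_var enum_rankK_in.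
by apply: (localized_M_unit kappa_inj monomial_in1 monomial_in_neq0); eexists.
Qed.

Lemma laurent_unitM x y : unit_in laurent x -> unit_in laurent y -> unit_in laurent (x * y).
Proof. exact: (unit_inM monomial_inM). Qed.

Lemma laurent_unitV x : unit_in laurent x -> unit_in laurent x^-1.
Proof. exact: unit_inV. Qed.

Lemma mon_swap i j : adj G i j ->
  mon (Umx i j) * mon (Umx j i) = mon (Umx i i) * mon (Umx j j).
Proof. by move=> ij; rewrite -!monD; apply: mon_expo; rewrite expo_swap. Qed.

(** A variable x_ab left out has b < a and equals x_aa x_bb / x_ba. *)
Lemma laurent_unit_var a b : unit_in laurent (mon (Umx a b)).
Proof.
have [ab|] := boolP ((a, b) \in gen_indices); first exact: laurent_unit_gen.
rewrite inE negb_or negbK /= => /andP[ab nlt].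
have -> : mon (Umx a b) = mon (Umx a a) * mon (Umx b b) * (mon (Umx b a))^-1.
  by rewrite -mon_swap // mulfK ?mon_neq0.
apply: laurent_unitM; first by apply: laurent_unitM; apply: laurent_unit_gen; rewrite inE adj_irr.
apply/laurent_unitV/laurent_unit_gen; rewrite inE /= adjC ab /=.
have neq : a != b by apply: contraTneq ab => ->; rewrite adj_irr.
by move: nlt neq; rewrite -val_eqE /=; lia.
Qed.

Lemma laurent_unit1 : unit_in laurent 1.
Proof.
by split; rewrite ?oner_neq0 ?invr1 //; apply: (localized1 _ monomial_in1).
Qed.

Lemma laurent_unit_mon (m : 'X_{1.. n * n}) : unit_in laurent (mon m).
Proof.
rewrite [m]multinomUE_id (big_morph mon monD mon0).
elim/big_ind: _ => [||k _]; [exact: laurent_unit1|exact: laurent_unitM|].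
elim: (m k) => [|p IHp]; first by rewrite mulm0n mon0; apply: laurent_unit1.
rewrite mulmS monD; apply: (laurent_unitM _ IHp) => {IHp}.
by case/mxvec_indexP: k => a b; apply: laurent_unit_var.
Qed.

Lemma laurentM x y : laurent x -> laurent y -> laurent (x * y).
Proof. exact: (localizedM monomial_inM). Qed.

Lemma laurentD x y : laurent x -> laurent y -> laurent (x + y).
Proof. exact: (localizedD kappa_inj monomial_inM monomial_in_neq0). Qed.

Lemma kappaC c : kappa c%:MP = to_frac c%:MP.
Proof. by rewrite /kappa /= /gen_emb mmapC. Qed.

Lemma laurent_const c : laurent (to_frac c%:MP).
Proof.
rewrite -kappaC; exact: (localized_kappa _ monomial_in1).
Qed.

Lemma laurent_base x : in_base x -> laurent x.
Proof.
move=> /in_base_frac[f ->]; rewrite [f]mpolyE rmorph_sum.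
elim/big_ind: _ => [||m _]; [|exact: laurentD|].
  by rewrite -[0](rmorph0 to_frac) -mpolyC0; apply: laurent_const.
rewrite -mul_mpolyC rmorphM; apply: laurentM; first exact: laurent_const.
by case: (laurent_unit_mon m).
Qed.

(** The numerators of x and of its inverse multiply to a monomial, and a divisor of a monomial is a
    constant times a monomial. *)
Lemma laurent_unitP x : unit_in laurent x -> exists c (m1 m2 : 'X_{1.. n * n}),
  c != 0 /\ x = to_frac c%:MP * (mon m1 / mon m2).
Proof.
move=> [x0 [a [_ [[m ->] ex]]] [b [_ [[l ->] exi]]]].
have e : a * b = 1 *: 'X_[m + l].
  rewrite scale1r mpolyXD; apply/eqP; rewrite -subr_eq0; apply/eqP/kappa_inj.
  have m0 : kappa 'X_[m] != 0 by rewrite -mon_gen mon_neq0.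
  have l0 : kappa 'X_[l] != 0 by rewrite -mon_gen mon_neq0.
  rewrite rmorphB !rmorphM /=; apply/eqP; rewrite subr_eq0.
  have h : kappa a * kappa b / (kappa 'X_[m] * kappa 'X_[l]) = 1.
    by rewrite -mulf_div -ex -exi mulfV.
  by apply/eqP; rewrite -[LHS](mulfVK (mulf_neq0 m0 l0)) h mul1r.
have [c c0 [s es]] := mpoly_monomial_divisor (oner_neq0 K) e.
exists c, (gen_mnm s), (gen_mnm m); split => //.
by rewrite ex es -mul_mpolyC rmorphM /= kappaC -!mon_gen mulrA.
Qed.

End ToricEmbedding.

Lemma mdotMn (N : nat) (w m : 'X_{1.. N}) k : mdot w (m *+ k)%MM = (k * mdot w m)%N.
Proof. by elim: k => [|k IHk]; rewrite ?mulm0n ?mdot0 // mulmS mdotD IHk mulSn. Qed.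

(** * Facet valuations on the fraction field *)

Section ToricValuations.
Variables (K : fieldType) (n : nat) (G : sgraph n).
Local Notation S := {mpoly K[n * n]}.
Local Notation F := {fraction (RG K G)}.
Local Notation laurent := (@laurent K n G).
Local Notation mon := (@mon K n G).
Implicit Types (f : facet G) (m : 'X_{1.. n * n}).

Lemma facet_weight_balanced f : balanced G (facet_weight G (val f)).
Proof. exact: facet_balanced (valP f). Qed.

Definition facet_valuation f : F -> int :=
  frac_val (wsubst_RG_M (K := K) (facet_weight_balanced f))
    (fun x => wsubst_RG_inj (facet_weight_balanced f)).

Lemma facet_valuationM f x y : x != 0 -> y != 0 ->
  facet_valuation f (x * y) = facet_valuation f x + facet_valuation f y.
Proof. exact: frac_valM. Qed.

Lemma facet_valuationD f (k : int) x y : x != 0 -> y != 0 -> x + y != 0 ->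
  k <= facet_valuation f x -> k <= facet_valuation f y -> k <= facet_valuation f (x + y).
Proof. exact/frac_valD/wsubst_RG_D/facet_weight_balanced. Qed.

Lemma facet_valuation_to_frac f (g : S) : to_frac G g != 0 ->
  facet_valuation f (to_frac G g) = (poly_ord (wsubst G (facet_weight G (val f)) g))%:Z.
Proof.
have wb := facet_weight_balanced f; rewrite /to_frac tofrac_eq0 => g0.
by rewrite /facet_valuation frac_val_tofrac ?wsubst_RGE // wsubst_RG_1.
Qed.

Lemma facet_valuation_mon f m : facet_valuation f (mon m) = (mdot (facet_weight G (val f)) m)%:Z.
Proof.
rewrite facet_valuation_to_frac; last exact: mon_neq0.
rewrite wsubstX; congr Posz.
apply: poly_ord_eq => [|i lti]; rewrite /wmonomial coefZ coefXn.
  by rewrite eqxx mulr1 monomial_neq0.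
by rewrite ltn_eqF // mulr0.
Qed.

Lemma to_frac_const_neq0 (c : K) : c != 0 -> to_frac G c%:MP != 0.
Proof. by rewrite -kappaC; apply: contra_neq => /kappa_inj/eqP; rewrite mpolyC_eq0 => /eqP. Qed.

Lemma facet_valuation_const f (c : K) : c != 0 -> facet_valuation f (to_frac G c%:MP) = 0.
Proof.
move=> c0; rewrite facet_valuation_to_frac ?to_frac_const_neq0 // wsubstC.
by rewrite (@poly_ord_eq _ _ 0) // coefC eqxx mpolyC_eq0.
Qed.

Lemma facet_valuation_mon_frac f m1 m2 : facet_valuation f (mon m1 / mon m2) =
  (mdot (facet_weight G (val f)) m1)%:Z - (mdot (facet_weight G (val f)) m2)%:Z.
Proof.
have q0 : mon m1 / mon m2 != 0 by rewrite mulf_neq0 ?invr_neq0 ?mon_neq0.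
have := facet_valuationM f q0 (mon_neq0 K G m2).
by rewrite mulfVK ?mon_neq0 // !facet_valuation_mon => ->; rewrite addrK.
Qed.

Lemma facet_valuation_monV f m1 m2 : facet_valuation f (mon m1 / mon m2) =
  facet_val G (val f) (fun a b => (m1 (mxvec_index a b))%:Z - (m2 (mxvec_index a b))%:Z).
Proof.
rewrite facet_valuation_mon_frac !mdot_facet -sumrB; apply: eq_bigr => a _; rewrite -sumrB.
by apply: eq_bigr => b _; rewrite mulrBr.
Qed.

Lemma laurent_unit_frac m1 m2 : unit_in laurent (mon m1 / mon m2).
Proof. by apply: laurent_unitM; [|apply: laurent_unitV]; apply: laurent_unit_mon. Qed.

Lemma laurent_unit_class t : unit_in laurent t -> class_map (facet_valuation^~ t) = 0.
Proof.
move=> /laurent_unitP[c [m1 [m2 [c0 ->]]]].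
rewrite -(@class_map_val n G (fun a b => (m1 (mxvec_index a b))%:Z - (m2 (mxvec_index a b))%:Z)).
congr class_map; apply: funext => f.
rewrite facet_valuationM ?to_frac_const_neq0 ?mulf_neq0 ?invr_neq0 ?mon_neq0 //.
by rewrite facet_valuation_const // add0r facet_valuation_monV.
Qed.

Lemma class_map_ker_laurent (d : facet G -> int) : class_map d = 0 ->
  exists2 t, unit_in laurent t & forall f, facet_valuation f t = d f.
Proof.
move=> /class_map_ker[u du].
pose pos (z : int) : nat := if z is Posz k then k else 0%N.
have posB (z : int) : (pos z)%:Z - (pos (- z))%:Z = z by case: z => [[|k]|k]; rewrite /= ?subr0 ?sub0r.
(* The positive part of u goes to the numerator, the negative part to the denominator. *)
exists (mon (mnm_of (fun a b => pos (u a b))) / mon (mnm_of (fun a b => pos (- u a b)))).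
  exact: laurent_unit_frac.
move=> f; rewrite facet_valuation_monV du; apply: eq_bigr => a _; apply: eq_bigr => b _.
by rewrite !mnm_ofE posB.
Qed.

Lemma laurent_unit_exact (d : facet G -> int) f0 : exists2 t, unit_in laurent t &
  (forall f, d f <= facet_valuation f t) /\ facet_valuation f0 t = d f0.
Proof.
have [p [q dpq]] : exists p q : nat, d f0 = p%:Z - q%:Z.
  by case: (d f0) => k; [exists k, 0%N; rewrite subr0|exists 0%N, k.+1; rewrite sub0r NegzE].
pose top := facet_top (val f0); pose inn := facet_interior G (val f0).
pose w f := facet_weight G (val f).
(* There are finitely many facets, so one M serves all: at f other than [f0] the power [inn *+ M]
   gains at least M, which covers both [d f] and the loss caused by the denominator [top *+ q]. *)
pose M := (\sum_f (absz (d f) + q * mdot (w f) top))%N.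
have leM f : (absz (d f) + q * mdot (w f) top <= M)%N by rewrite /M (bigD1 f) //= leq_addr.
pose t := mon (inn *+ M + top *+ p)%MM / mon (top *+ q)%MM.
have vt f : facet_valuation f t =
    (M * mdot (w f) inn + p * mdot (w f) top)%N%:Z - (q * mdot (w f) top)%N%:Z.
  by rewrite facet_valuation_mon_frac mdotD !mdotMn.
have vt0 : facet_valuation f0 t = d f0.
  rewrite vt dpq /w /inn facet_interior0 muln0 add0n /top facet_topE ?muln1 //.
  exact: valP.
exists t; first exact: laurent_unit_frac.
split=> // f; have [->|nf] := eqVneq f f0; first by rewrite vt0.
have : (0 < mdot (w f) inn)%N by apply: facet_interior_gt0; rewrite ?(valP f) ?(valP f0) // eq_sym.
rewrite vt; have := leM f; case: (mdot (w f) inn) => // k; rewrite mulnS; lia.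
Qed.

Lemma laurent_unit_above (d : facet G -> int) :
  exists2 t, unit_in laurent t & forall f, d f <= facet_valuation f t.
Proof.
(* Without vertices there is no facet at which to ask for exactness. *)
case: (pickP (xpredT : pred (facet G))) => [f0 _|no].
  by have [t ut [dt _]] := laurent_unit_exact d f0; exists t.
by exists 1; [apply: laurent_unit1|move=> f; have := no f].
Qed.

(** Conversely, x times a monomial [m0] is a standard polynomial g. By the absence of cancellation,
    v_f(x) >= 0 bounds the f-value of every monomial s of g below by that of [m0]; normality then
    divides each s by [m0] within the semigroup. *)
Lemma in_base_facet x :
  in_base x <-> laurent x /\ forall f, x != 0 -> 0 <= facet_valuation f x.
Proof.
split=> [bx|[[a [_ [[l ->] ex]]] vx]].
  split=> [|f]; first exact: laurent_base.
  by have [g ->] := in_base_frac bx => g0; rewrite facet_valuation_to_frac.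
have [x0|x0] := eqVneq x 0; first by rewrite x0; apply: in_base0.
have {}ex : x = kappa a / mon (gen_mnm l) by rewrite mon_gen.
set m0 := gen_mnm l in ex.
have [g std_g Pg] := standard_repr G (gen_emb a).
have eg : x * mon m0 = to_frac G g.
  rewrite ex mulfVK ?mon_neq0 //; apply/eqP; rewrite -subr_eq0; apply/eqP.
  by rewrite /kappa /= -rmorphB; apply/to_frac_eq0.
have g0 : to_frac G g != 0 by rewrite -eg mulf_neq0 ?mon_neq0.
have le_supp s f : s \in msupp g ->
    (mdot (facet_weight G (val f)) m0 <= mdot (facet_weight G (val f)) s)%N.
  move=> sg; rewrite leqNgt; apply/negP => lt.
  have := facet_valuationM f x0 (mon_neq0 K G m0).
  rewrite eg facet_valuation_mon (facet_valuation_to_frac f g0) => ev.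
  have le : (mdot (facet_weight G (val f)) m0 <=
      poly_ord (wsubst G (facet_weight G (val f)) g))%N.
    by have := vx f x0; lia.
  have := wsubst_coef (facet_weight G (val f)) std_g (std_g s sg).
  move: sg; rewrite mcoeff_msupp => gs e; move: gs.
  by rewrite -e poly_ord_before ?mcoeff0 ?eqxx // (leq_trans lt).
suff -> : x = \sum_(s <- msupp g) to_frac G (g@_s)%:MP * (mon s / mon m0).
  rewrite big_seq; elim/big_ind: _ => [|? ?|s sg]; [exact: in_base0|exact: in_baseD|].
  apply: in_baseM; first exact: in_base_to_frac.
  have [|t et] := @facet_normal n G m0 s.
    by move=> y fy; have := le_supp s (Sub y fy) sg.
  by rewrite (mon_expo K et) monD mulrC mulKf ?mon_neq0 //; apply: in_base_to_frac.
apply: (mulIf (mon_neq0 K G m0)); rewrite eg {1}[g]mpolyE rmorph_sum mulr_suml.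
apply: eq_bigr => s _; rewrite -mul_mpolyC rmorphM /= -mulrA mulfVK ?mon_neq0 //.
Qed.

End ToricValuations.

Theorem theorem2p2 (K : fieldType) (n : nat) (G : sgraph n) :
  exists r : nat,
    r%:Z = (\sum_(i < n) 2 ^ degree G i)%N%:Z - n%:Z - #|edges G|%:Z
    /\ free_abelian_of_rank (class_group (RG K G)) r.
Proof.
exists #|free_indices G|; split.
  by rewrite -card_free_indices !PoszD; ring.
apply: (class_group_free (T := @laurent K n G) (v := @facet_valuation K n G) (q := @class_map n G)).
- by case: (@laurent_unit1 K n G).
- exact: laurentM.
- exact: laurentD.
- exact: laurent_factorial.
- exact: facet_valuationM.
- exact: facet_valuationD.
- exact: in_base_facet.
- exact: laurent_unit_above.
- exact: laurent_unit_exact.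
- exact: class_mapD.
- exact: class_map_surj.
- exact: laurent_unit_class.
- exact: class_map_ker_laurent.
Qed.
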